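(* Let $(E,<)$ be a finite totally ordered set and $r\ge 1$. For every hyperline sequence $X$ of rank $r$ over $E$ (i.e. with $E(X)=E$), the set of positively oriented bases of $X$ is the set of positively oriented bases of some chirotope of rank $r$ over $E$. Conversely, for every chirotope $\chi$ of rank $r$ over $E$, the set of positively oriented bases of $\chi$ is the set of positively oriented bases of some hyperline sequence of rank $r$ over $E$.
   Context: Signed indices: let $\overline E=\{\overline e\mid e\in E\}$ be a disjoint copy of $E$ and $\mathbf E=E\sqcup\overline E$; extend $e\mapsto\overline e$ to an involution by $\overline{\overline e}=e$. Put $e^*=\overline e^*=e$, and for $X\subset\mathbf E$ put $\overline X=\{\overline x\mid x\in X\}$, $X^*=\{x^*\mid x\in X\}$. Oriented simplices: an oriented $d$-simplex in $E$ is a tuple $[x_1,\dots,x_{d+1}]$ of elements of $\mathbf E$ with $x_1^*,\dots,x_{d+1}^*$ pairwise distinct; $\Delta_d(E)$ is the set of these. The equivalence $\sim$ on oriented $d$-simplices is generated by $[x_1,\dots,x_{d+1}]\sim[x_1,\dots,x_{i-1},\overline{x_{i+1}},x_i,x_{i+2},\dots,x_{d+1}]$ ($i=1,\dots,d$). Put $-[x_1,\dots,x_{d+1}]=[x_1,\dots,x_d,\overline{x_{d+1}}]$. Chirotope of rank $r$ over $E$: a map $\chi:\Delta_{r-1}(E)\to\{-1,0,+1\}$ (with the convention that $\chi$ of a tuple that is not an oriented simplex is $0$) such that (C1) for each $e_1\in E$ there are $e_2,\dots,e_r\in E$ with $\chi([e_1,\dots,e_r])\ne0$; (C2) $\chi(-\sigma)=-\chi(\sigma)$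 for all $\sigma$, and $\sigma\sim\tau$ implies $\chi(\sigma)=\chi(\tau)$; (C3) if $\chi([x_1,\dots,x_r])\neq0$ and $\chi([y_1,\dots,y_r])\ne0$, then $\chi([x_1,\dots,x_{r-1},y_i])\neq 0$ for some $i$; (C4) if $x_1,\dots,x_r,y_1,y_2\in\mathbf E$ satisfy $\chi([x_1,\dots,x_{r-2},y_1,x_r])\cdot\chi([x_1,\dots,x_{r-1},y_2])\ge0$ and $\chi([x_1,\dots,x_{r-2},y_2,x_r])\cdot\chi([x_1,\dots,x_{r-1},\overline{y_1}])\ge0$, then $\chi([x_1,\dots,x_r])\cdot\chi([x_1,\dots,x_{r-2},y_1,y_2])\ge0$. A positively oriented base of $\chi$ is a $\sigma$ with $\chi(\sigma)=+1$. Hyperline sequences (defined recursively; $C_m=\mathbb Z/m$). Rank 1: a hyperline sequence over $E(X)\subset E$ is a nonempty $X\subset E(X)\cup\overline{E(X)}$ with $|X|=|X^*|$ and $X^*=E(X)$; its positively oriented bases are $[x]$, $x\in X$; $-X:=\overline X$. Rank 2: for some $k\ge2$, a map $a\mapsto X^a$ from $C_{2k}$ to rank-1 hyperline sequences (the atoms) with $X^{a+k}=-X^a$ for all $a$ and $E(X)\cup\overline{E(X)}$ the disjoint union of $X^0,\dots,X^{2k-1}$. $e$ is incident to $X^a$ if $e\in(X^a)^*$. $[x_1,x_2]$ is a positively oriented base if $x_1^*,x_2^*$ are not incident to a single atom and the atoms containing $x_1,x_2,\overline{x_1},\overline{x_2}$ occur in this cyclic order. $(-X)^a:=X^{-a}$.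 Two rank-2 sequences are equal if they have the same $E(X)$, same period $2k$ and differ by a shift of $C_{2k}$. Rank $r>2$: a nonempty set $X$ of pairs $(Y|Z)$ (hyperlines), $Y$ a hyperline sequence of rank $r-2$ and $Z$ of rank $2$. A positively oriented base of $X$ is an oriented simplex $[x_1,\dots,x_r]$ such that for some $(Y|Z)\in X$, $[x_1,\dots,x_{r-2}]$ is a positively oriented base of $Y$ and $[x_{r-1},x_r]$ one of $Z$. Put $-X=\{(Y|-Z)\mid (Y|Z)\in X\}$. $X$ is a hyperline sequence of rank $r$ over $E(X)$ if: (H1) $E(X)$ is the disjoint union of $E(Y)$ and $E(Z)$ for every $(Y|Z)\in X$; (H2) if $(Y_1|Z_1),(Y_2|Z_2)\in X$, $[x_1,\dots,x_{r-2}]$ is a positively oriented base of $Y_1$ and $\{x_1^*,\dots,x_{r-2}^*\}\subset E(Y_2)$, then $(Y_1|Z_1)=(Y_2|Z_2)$ or $(Y_1|Z_1)=(-Y_2|-Z_2)$; (H3) for all positively oriented bases $[x_1,\dots,x_r]$, $[y_1,\dots,y_r]$ of $X$ there is $j$ with $[x_1,\dots,x_{r-1},y_j]$ or $[x_1,\dots,x_{r-1},\overline{y_j}]$ a positively oriented base of $X$; (H4) if $[x_1,\dots,x_r]$ is a positively oriented base of $X$ then so is $[x_1,\dots,x_{r-3},\overline{x_{r-1}},x_{r-2},x_r]$.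
   Formalization: In the converse direction E is assumed nonempty: over the empty set the zero map satisfies (C1)–(C4) vacuously, but there is no hyperline sequence over the empty set, so the converse fails there. *)

(* Defs.v *)
From HB Require Import structures.
From mathcomp Require Import all_boot all_order all_algebra.

Set Implicit Arguments.
Unset Strict Implicit.
Unset Printing Implicit Defensive.

Import Order.TTheory GRing.Theory Num.Theory.
Local Open Scope ring_scope.

(* [inl e] is the element e itself and [inr e] is its barred copy. *)
Definition signed (E : finType) : finType := (E + E)%type.

Definition bar {E : finType} (x : signed E) : signed E :=
  match x with inl e => inr e | inr e => inl e end.

Definition star {E : finType} (x : signed E) : E :=
  match x with inl e => e | inr e => e end.

Definition barset {E : finType} (X : {set signed E}) : {set signed E} :=
  [set bar x | x in X].

Definition starset {E : finType} (X : {set signed E}) : {set E} :=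
  [set star x | x in X].

(* F together with its barred copy, as a set of signed indices. *)
Definition both_signs {E : finType} (F : {set E}) : {set signed E} :=
  [set x | star x \in F].

(* Tuples are lists; [oriented r s] says that s is an oriented (r-1)-simplex. *)
Definition oriented {E : finType} (r : nat) (s : seq (signed E)) : bool :=
  (size s == r) && uniq (map star s).

(* The step [x_1 .. x_{d+1}] ~ [x_1 .. bar x_{i+1}, x_i .. x_{d+1}] permutes
   the underlying indices, so it stays within the oriented simplices. *)
Inductive simplex_equiv {E : finType} :
    seq (signed E) -> seq (signed E) -> Prop :=
| SimplexSwap s x y t :
    simplex_equiv (s ++ [:: x, y & t]) (s ++ [:: bar y, x & t])
| SimplexRefl s : simplex_equiv s s
| SimplexSym s t : simplex_equiv s t -> simplex_equiv t s
| SimplexTrans s t u :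
    simplex_equiv s t -> simplex_equiv t u -> simplex_equiv s u.

Definition simplex_opp {E : finType} (s : seq (signed E)) : seq (signed E) :=
  match s with
  | [::] => [::]
  | x :: s' => rcons (belast x s') (bar (last x s'))
  end.

(* A map on oriented (r-1)-simplices is given by its extension by 0 to all
   lists.  In rank 1 the last axiom is vacuous. *)
Record chirotope {E : finType} (r : nat) (chi : seq (signed E) -> int) :
    Prop := Chirotope {
  chi_range : forall s, chi s \in [:: -1; 0; 1];
  chi_nonsimplex : forall s, ~~ oriented r s -> chi s = 0;
  chi_C1 : forall e1 : E, exists es : seq E,
    size (e1 :: es) = r /\ chi (map inl (e1 :: es)) != 0;
  chi_C2_opp : forall s, oriented r s -> chi (simplex_opp s) = - chi s;
  chi_C2_equiv : forall s t, oriented r s -> oriented r t ->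
    simplex_equiv s t -> chi s = chi t;
  chi_C3 : forall s x t, chi (rcons s x) != 0 -> chi t != 0 ->
    exists2 y, y \in t & chi (rcons s y) != 0;
  chi_C4 : forall p x x' y1 y2, (size p).+2 = r ->
    0 <= chi (p ++ [:: y1; x']) * chi (p ++ [:: x; y2]) ->
    0 <= chi (p ++ [:: y2; x']) * chi (p ++ [:: x; bar y1]) ->
    0 <= chi (p ++ [:: x; x']) * chi (p ++ [:: y1; y2])
}.

Definition chi_posbase {E : finType} (chi : seq (signed E) -> int)
  (s : seq (signed E)) : Prop := chi s = 1.

Definition hseq1_posbase {E : finType} (X : {set signed E})
  (s : seq (signed E)) : Prop := exists2 x, x \in X & s = [:: x].

(* Over the empty set there is no such X, whereas the zero map is a chirotope
   of every positive rank over it. *)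
Definition is_hseq1 {E : finType} (F : {set E}) (X : {set signed E}) : Prop :=
  [/\ X != set0, #|X| = #|starset X| & starset X = F].

(* A map from Z/2k to sets of signed indices, k being [half_period].  The type
   'Z_(k.*2) is Z/2k as soon as k > 0, which [is_hseq2] ensures. *)
Record hseq2 (E : finType) := Hseq2 {
  half_period : nat;
  atom : {ffun 'Z_(half_period.*2) -> {set signed E}}
}.

Definition is_hseq2 {E : finType} (F : {set E}) (Z : hseq2 E) : Prop :=
  [/\ (2 <= half_period Z)%N,
      forall a, is_hseq1 (starset (atom Z a)) (atom Z a),
      forall a, atom Z (a + (half_period Z)%:R) = barset (atom Z a),
      \bigcup_a atom Z a = both_signs F
    & forall a b, a != b -> [disjoint atom Z a & atom Z b]].

Definition hseq2_opp {E : finType} (Z : hseq2 E) : hseq2 E :=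
  Hseq2 [ffun a => atom Z (- a)].

Definition hseq2_shift {E : finType} (Z : hseq2 E)
    (c : 'Z_((half_period Z).*2)) : hseq2 E :=
  Hseq2 [ffun a => atom Z (a + c)].
Arguments hseq2_shift {E} Z c.

Definition hseq2_eq {E : finType} (Z Z' : hseq2 E) : Prop :=
  exists c, Z' = hseq2_shift Z c.

(* Starting from a and going round once, one meets b, then c, then d; the
   differences are compared as natural numbers less than n. *)
Definition cyclic_order4 (n : nat) (a b c d : 'Z_n) : bool :=
  (0 < val (b - a)%R < val (c - a)%R)%N
  && (val (c - a)%R < val (d - a)%R)%N.

Definition incident {E : finType} (Z : hseq2 E) (e : E)
  (a : 'Z_((half_period Z).*2)) : bool := e \in starset (atom Z a).
Arguments incident {E} Z e a.

Definition hseq2_posbase {E : finType} (Z : hseq2 E)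
    (s : seq (signed E)) : Prop :=
  exists x1 x2, [/\ s = [:: x1; x2],
    ~ (exists a, incident Z (star x1) a /\ incident Z (star x2) a)
  & exists a b c d,
      [/\ x1 \in atom Z a, x2 \in atom Z b,
          bar x1 \in atom Z c, bar x2 \in atom Z d & cyclic_order4 a b c d]].

(* What a rank contributes to the recursion: the type of candidate hyperline
   sequences of that rank, their equality, X |-> -X, their positively oriented
   bases, and the relation "X is a hyperline sequence with E(X) = F". *)
Record rank_data (E : finType) := RankData {
  rd_type : Type;
  rd_eq : rd_type -> rd_type -> Prop;
  rd_opp : rd_type -> rd_type;
  rd_posbase : rd_type -> seq (signed E) -> Prop;
  rd_is_hseq : {set E} -> rd_type -> Prop
}.

Definition rank0 (E : finType) : rank_data E :=
  @RankData E Empty_set (fun _ _ => True) id (fun _ _ => False)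
    (fun _ _ => False).

Definition rank1 (E : finType) : rank_data E :=
  @RankData E {set signed E} eq barset hseq1_posbase is_hseq1.

Definition rank2 (E : finType) : rank_data E :=
  @RankData E (hseq2 E) hseq2_eq hseq2_opp hseq2_posbase is_hseq2.

Section HigherRank.

(* D describes rank n; a set X of hyperlines, [X Y Z] meaning that the pair
   (Y|Z) belongs to X, is a candidate of rank n.+2. *)
Context {E : finType} (n : nat) (D : rank_data E).

Definition hyperlines : Type := rd_type D -> hseq2 E -> Prop.

(* Equality of sets of pairs, with respect to the equalities in rank n and in
   rank 2 (where sequences differing by a shift are equal). *)
Definition hyperlines_eq (X X' : hyperlines) : Prop :=
  (forall Y Z, X Y Z ->
     exists Y' Z', [/\ X' Y' Z', rd_eq Y Y' & hseq2_eq Z Z']) /\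
  (forall Y' Z', X' Y' Z' ->
     exists Y Z, [/\ X Y Z, rd_eq Y Y' & hseq2_eq Z Z']).

Definition hyperlines_opp (X : hyperlines) : hyperlines :=
  fun Y Z => exists2 Z0, X Y Z0 & Z = hseq2_opp Z0.

Definition hyperlines_posbase (X : hyperlines) (s : seq (signed E)) : Prop :=
  oriented n.+2 s /\
  exists Y Z,
    [/\ X Y Z, rd_posbase Y (take n s) & hseq2_posbase Z (drop n s)].

(* In H2, E(Y2) is the set FY2 such that Y2 is a hyperline sequence over FY2;
   it is unique by [is_hseq_ground_uniq]. *)
Record is_hyperlines (F : {set E}) (X : hyperlines) : Prop := IsHyperlines {
  hyperlines_nonempty : exists Y Z, X Y Z;
  hyperlines_H1 : forall Y Z, X Y Z -> exists FY FZ,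
    [/\ rd_is_hseq FY Y, is_hseq2 FZ Z, F = FY :|: FZ & [disjoint FY & FZ]];
  hyperlines_H2 : forall Y1 Z1 Y2 Z2 FY2 s,
    X Y1 Z1 -> X Y2 Z2 -> rd_posbase Y1 s ->
    rd_is_hseq FY2 Y2 -> {subset map star s <= FY2} ->
    (rd_eq Y1 Y2 /\ hseq2_eq Z1 Z2) \/
    (rd_eq Y1 (rd_opp Y2) /\ hseq2_eq Z1 (hseq2_opp Z2));
  hyperlines_H3 : forall s x t,
    hyperlines_posbase X (rcons s x) -> hyperlines_posbase X t ->
    exists2 y, y \in t & hyperlines_posbase X (rcons s y) \/
                         hyperlines_posbase X (rcons s (bar y));
  hyperlines_H4 : forall p x y z,
    hyperlines_posbase X (p ++ [:: x; y; z]) ->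
    hyperlines_posbase X (p ++ [:: bar y; x; z])
}.

Definition rank_up : rank_data E :=
  RankData hyperlines_eq hyperlines_opp hyperlines_posbase is_hyperlines.

End HigherRank.

(* Rank 0 is a dummy without any hyperline sequence. *)
Fixpoint rank_datum (E : finType) (r : nat) : rank_data E :=
  match r with
  | 0 => rank0 E
  | 1 => rank1 E
  | 2 => rank2 E
  | (_.+1 as n).+2 => rank_up n (rank_datum E n)
  end.

Definition hseq (E : finType) (r : nat) : Type := rd_type (rank_datum E r).

Definition hseq_posbase {E : finType} {r : nat} (X : hseq E r)
  (s : seq (signed E)) : Prop := rd_posbase X s.

Definition is_hseq {E : finType} {r : nat} (F : {set E}) (X : hseq E r) :
  Prop := rd_is_hseq F X.

Lemma both_signs_inj (E : finType) : injective (@both_signs E).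
Proof.
move=> F F' /setP eqF; apply/setP => e.
by have := eqF (inl e); rewrite !inE.
Qed.

Lemma is_hseq_ground_uniq (E : finType) (r : nat) (F F' : {set E})
  (X : hseq E r) : is_hseq F X -> is_hseq F' X -> F = F'.
Proof.
elim/ltn_ind: r F F' X => -[//|[|[|q]]] IH F F' X.
- by case=> _ _ <- [_ _ <-].
- by case=> _ _ _ eF _ [_ _ _ eF' _]; apply: both_signs_inj; rewrite -eF -eF'.
case=> -[Y [Z XYZ]] H1 _ _ _ [_ H1' _ _ _].
have [A [B [hA hB -> _]]] := H1 _ _ XYZ.
have [A' [B' [hA' hB' -> _]]] := H1' _ _ XYZ.
have -> : A = A' by apply: (IH q.+1) hA hA'.
by have -> : B = B' by apply: (IH 2%N _ _ _ Z).
Qed.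

(* Main.v *)
Require Import Defs.
From HB Require Import structures.
From mathcomp Require Import all_boot all_order all_algebra.
From mathcomp Require Import zify boolp.

Set Implicit Arguments.
Unset Strict Implicit.
Unset Printing Implicit Defensive.

Import Order.TTheory GRing.Theory Num.Theory.
Local Open Scope ring_scope.

(* In both directions one argues by induction on the rank, over arbitrary
   subsets F of the ground set, going from rank n to rank n + 2.

   A hyperline sequence X of rank n + 2 gives a sign map: +1 on its positively
   oriented bases, -1 on their opposites.  By H2 the line (Y|Z) whose Y has
   [x_1 .. x_n] as a positively oriented base is unique, so fixing x_1 .. x_n
   turns C4 for X into C4 for Z, which is a statement on four points of a circle.

   Conversely, let chi be a chirotope of rank n + 2.  A flat L of rank n with
   basis b gives a restriction s |-> chi (s ++ [z1; z2]) to L and a contraction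
   t |-> chi (b ++ t) of rank 2 on F \ L, hence by induction a pair (Y|Z).  Two
   bases of L yield the same contraction up to one global sign: when a single
   element is exchanged, a term of the three-term relation vanishes, and any two
   bases of L are joined by exchanges.  So chi (s ++ t) is the product of the two
   signs, and the pairs (Y|Z), (-Y|-Z) over all flats L form the hyperline
   sequence.  In rank 2 the atoms are the classes of codirectional elements,
   sorted within a half-plane. *)

(** * Chirotopes over a subset of the ground set *)

Section SignedIndices.

Context {E : finType}.
Implicit Types (x y : signed E) (p q s t : seq (signed E)).

Lemma barK : involutive (@bar E).
Proof. by case. Qed.

Lemma star_bar x : star (bar x) = star x.
Proof. by case: x. Qed.

Lemma bar_neq x : bar x != x.
Proof. by case: x. Qed.

Lemma star_inlP x : x = inl (star x) \/ x = bar (inl (star x)).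
Proof. by case: x; [left | right]. Qed.

Lemma star_eqP x y : star x = star y -> x = y \/ x = bar y.
Proof. by case: x; case: y => a b /= ->; [left|right|right|left]. Qed.

Lemma mem_barset x (A : {set signed E}) : (x \in barset A) = (bar x \in A).
Proof.
apply/imsetP/idP => [[y yA ->]|bxA]; first by rewrite barK.
by exists (bar x); rewrite ?barK.
Qed.

Lemma mem_starset (e : E) (A : {set signed E}) :
  (e \in starset A) = (inl e \in A) || (inr e \in A).
Proof.
apply/imsetP/orP => [[[f|f] fA ->]|[eA|eA]]; [by left|by right| |].
  by exists (inl e).
by exists (inr e).
Qed.

Lemma mem_starset_star x (A : {set signed E}) :
  (star x \in starset A) = (x \in A) || (bar x \in A).
Proof. by rewrite mem_starset; case: x => //= e; rewrite orbC. Qed.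

Lemma simplex_opp_rcons s x : simplex_opp (rcons s x) = rcons s (bar x).
Proof. by case: s => //= y s; rewrite belast_rcons last_rcons. Qed.

Lemma simplex_oppK : involutive (@simplex_opp E).
Proof. by case/lastP => // s x; rewrite !simplex_opp_rcons barK. Qed.

Lemma simplex_opp_cat s x t :
  simplex_opp (s ++ x :: t) = s ++ simplex_opp (x :: t).
Proof.
by rewrite lastI -rcons_cat !simplex_opp_rcons rcons_cat.
Qed.

Lemma map_star_opp s : map star (simplex_opp s) = map star s.
Proof.
by case/lastP: s => // s x; rewrite simplex_opp_rcons !map_rcons star_bar.
Qed.

Lemma oriented_opp r s : oriented r (simplex_opp s) = oriented r s.
Proof. by rewrite /oriented -(size_map star) map_star_opp size_map. Qed.

Lemma oriented_bar r p x q :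
  oriented r (p ++ bar x :: q) = oriented r (p ++ x :: q).
Proof. by rewrite /oriented !size_cat /= !map_cat /= star_bar. Qed.

Lemma oriented_swap r p x y q :
  oriented r (p ++ [:: y, x & q]) = oriented r (p ++ [:: x, y & q]).
Proof.
rewrite /oriented !size_cat /= !map_cat /=; congr (_ && _).
apply: perm_uniq; rewrite perm_cat2l.
by rewrite -[[:: _, _ & _]]/([:: _] ++ [:: _] ++ _) perm_catCA.
Qed.

(** The induction passes to restrictions and contractions, which live on subsets of [E]; hence the
    ground set [F]. C2 takes the equivalent local form that a bar at any place, and a swap of two
    neighbours, change the sign. *)
Record chirotope_on (F : {set E}) (r : nat) (chi : seq (signed E) -> int) :
    Prop := ChirotopeOn {
  cho_range : forall s, chi s \in [:: -1; 0; 1];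
  cho_oriented : forall s, chi s != 0 -> oriented r s;
  cho_ground : forall s, chi s != 0 -> {subset map star s <= F};
  cho_C1 : forall e, e \in F -> exists2 s, chi s != 0 & e \in map star s;
  cho_bar : forall p x q, chi (p ++ bar x :: q) = - chi (p ++ x :: q);
  cho_swap : forall p x y q,
    chi (p ++ [:: y, x & q]) = - chi (p ++ [:: x, y & q]);
  cho_C3 : forall s x t, chi (rcons s x) != 0 -> chi t != 0 ->
    exists2 y, y \in t & chi (rcons s y) != 0;
  cho_C4 : forall p x x' y1 y2, (size p).+2 = r ->
    0 <= chi (p ++ [:: y1; x']) * chi (p ++ [:: x; y2]) ->
    0 <= chi (p ++ [:: y2; x']) * chi (p ++ [:: x; bar y1]) ->
    0 <= chi (p ++ [:: x; x']) * chi (p ++ [:: y1; y2])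
}.

Lemma chi_opp F r chi s : (0 < r)%N -> chirotope_on F r chi ->
  chi (simplex_opp s) = - chi s.
Proof.
move=> r0 H; case/lastP: s => [|s x].
  suff -> : chi [::] = 0 by rewrite oppr0.
  apply/eqP; apply: contraTT r0 => /(cho_oriented H) /andP[/eqP<-].
  by [].
by rewrite simplex_opp_rcons -!cats1 (cho_bar H).
Qed.

Lemma chi_cases F r chi s : chirotope_on F r chi ->
  [\/ chi s = -1, chi s = 0 | chi s = 1].
Proof.
move=> H; have := cho_range H s; rewrite !inE.
by case/or3P => /eqP; [constructor 1|constructor 2|constructor 3].
Qed.

(* Quantifying over the continuation w makes the sign uniform in w. *)
Definition sign_eq (chi : seq (signed E) -> int) s t : Prop :=
  (forall w, chi (s ++ w) = chi (t ++ w)) \/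
  (forall w, chi (s ++ w) = - chi (t ++ w)).

Lemma sign_eq_refl chi s : sign_eq chi s s.
Proof. by left. Qed.

Lemma sign_eq_sym chi s t : sign_eq chi s t -> sign_eq chi t s.
Proof. by case=> h; [left|right] => w; rewrite h ?opprK. Qed.

Lemma sign_eq_trans chi t s u :
  sign_eq chi s t -> sign_eq chi t u -> sign_eq chi s u.
Proof.
by case=> h [] h'; [left|right|right|left] => w; rewrite h h' ?opprK.
Qed.

Lemma sign_eq_neq0 chi s t w :
  sign_eq chi s t -> (chi (s ++ w) != 0) = (chi (t ++ w) != 0).
Proof. by case=> ->; rewrite ?oppr_eq0. Qed.

Lemma sign_eq_bars F r chi p q q' : chirotope_on F r chi ->
  map star q = map star q' -> sign_eq chi (p ++ q) (p ++ q').
Proof.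
move=> H; elim: q p q' => [|x q IH] p [|y q'] //= => [_|[exy eqq]].
  exact: sign_eq_refl.
apply: (@sign_eq_trans _ (p ++ y :: q)); last by rewrite -!cat_rcons; exact: IH.
case/star_eqP: exy => ->; first exact: sign_eq_refl.
by right=> w; rewrite -!catA; exact: (cho_bar H).
Qed.

Lemma sign_eq_catCA F r chi p q s t : chirotope_on F r chi ->
  sign_eq chi (p ++ q ++ s ++ t) (p ++ s ++ q ++ t).
Proof.
move=> H; have move1 p' x u v : sign_eq chi (p' ++ x :: u ++ v) (p' ++ u ++ x :: v).
  elim: u p' => [|y u IH] p'; first exact: sign_eq_refl.
  apply: (@sign_eq_trans _ (p' ++ y :: x :: u ++ v)).
    by right=> w; rewrite -!catA; exact: (cho_swap H).
  by have := IH (rcons p' y); rewrite !cat_rcons.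
elim: q p => [|x q IH] p; first exact: sign_eq_refl.
apply: (@sign_eq_trans _ (p ++ x :: s ++ q ++ t)); last exact: move1.
by have := IH (rcons p x); rewrite !cat_rcons.
Qed.

(** Bars change only the sign, so both lists may be taken unbarred; permutations are then generated
    by exchanges of adjacent blocks. *)
Lemma sign_eq_perm_star F r chi s t : chirotope_on F r chi ->
  perm_eq (map star s) (map star t) -> sign_eq chi s t.
Proof.
move=> H pst.
have un u : sign_eq chi u (map inl (map star u)).
  apply: (sign_eq_bars [::] H).
  by rewrite -[RHS]map_comp map_id_in // => e _.
apply: sign_eq_trans (un s) _; apply: sign_eq_trans (sign_eq_sym (un t)).
have {}pst := perm_map (inl : E -> signed E) pst.
move: (map inl (map star s)) (map inl (map star t)) pst => s' t' pst.
apply: (@catCA_perm_ind _ (sign_eq chi s')) pst (sign_eq_refl _ _).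
move=> p q u h; apply: sign_eq_trans h _.
exact: (sign_eq_catCA [::] _ _ _ H).
Qed.

Lemma chi_neq0_perm_star F r chi s t : chirotope_on F r chi ->
  perm_eq (map star s) (map star t) -> chi s != 0 -> chi t != 0.
Proof.
move=> H /(sign_eq_perm_star H) /(@sign_eq_neq0 _ _ _ [::]).
by rewrite !cats0 => ->.
Qed.

(** Each element of [q] is passed twice, so the signs cancel. This frees the last places, the ones
    that C3 and C4 speak of. *)
Lemma chi_move2 F r chi z1 z2 q t : chirotope_on F r chi ->
  chi (q ++ [:: z1, z2 & t]) = chi ([:: z1, z2 & q] ++ t).
Proof.
move=> H; elim/last_ind: q t => // q x IH t.
rewrite -rcons_cons -rcons_cons !cat_rcons -IH (cho_swap H).
by rewrite -[in LHS]cat_rcons (cho_swap H) opprK cat_rcons.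
Qed.

Lemma chirotope_onT r chi : (0 < r)%N -> chirotope r chi ->
  chirotope_on [set: E] r chi.
Proof.
move=> r0 [Hrange Hns C1 Copp Cequiv C3 C4].
have ori s : chi s != 0 -> oriented r s by apply: contraNT => /Hns ->.
have sw p x y q : chi (p ++ [:: bar y, x & q]) = chi (p ++ [:: x, y & q]).
  have [o|no] := boolP (oriented r (p ++ [:: x, y & q])).
    apply/esym/Cequiv => //; last exact: SimplexSwap.
    by rewrite oriented_bar oriented_swap.
  by rewrite !Hns // oriented_bar oriented_swap.
(* Two steps of the simplex equivalence move a bar one place to the right; at the last place it is
   the opposite. *)
have br p x q : chi (p ++ bar x :: q) = - chi (p ++ x :: q).
  elim: q p x => [|y q IH] p x.
    rewrite !cats1 -simplex_opp_rcons.
    have [o|no] := boolP (oriented r (rcons p x)); first exact: Copp.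
    by rewrite !Hns ?oriented_opp // oppr0.
  by rewrite -[LHS]sw -[LHS]sw barK -cat_rcons IH cat_rcons.
split=> //.
- by move=> s _ e; rewrite in_setT.
- move=> e _; have [es [_ nz]] := C1 e; exists (map inl (e :: es)) => //.
  by rewrite inE eqxx.
- by move=> p x y q; rewrite -(sw p x) br opprK.
Qed.

Lemma chirotopeT r chi : (0 < r)%N -> chirotope_on [set: E] r chi ->
  chirotope r chi.
Proof.
move=> r0 H; split.
- exact: cho_range H.
- by move=> s no; apply/eqP; apply: contraNT no; exact: (cho_oriented H).
- move=> e; have [s nz es] := cho_C1 H (in_setT e).
  (* C1 asks for an unbarred base that starts with [e]; permuting and removing bars keeps the sign
     nonzero. *)
  have ps : perm_eq (map star s) (e :: rem e (map star s)).
    exact: perm_to_rem.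
  exists (rem e (map star s)); split.
    by rewrite -(perm_size ps) size_map; case/andP: (cho_oriented H nz) => /eqP.
  apply: chi_neq0_perm_star H _ nz.
  by rewrite -[X in perm_eq _ X]map_comp map_id_in.
- by move=> s _; exact: chi_opp H.
- move=> s t _ _; elim=> [p x y q|||s1 s2 s3 _ -> _ ->] //.
  by rewrite (cho_bar H) -(cho_swap H).
- exact: cho_C3 H.
- exact: cho_C4 H.
Qed.

(* The oriented bases alone, in the form in which hyperline sequences provide
   them; [chi_of] recovers the sign map. *)
Record oriented_bases (F : {set E}) (r : nat) (P : seq (signed E) -> Prop) :
    Prop := OrientedBases {
  ob_oriented : forall s, P s -> oriented r s;
  ob_ground : forall s, P s -> {subset map star s <= F};
  ob_swap : forall p x y q,
    P (p ++ [:: x, y & q]) -> P (p ++ [:: bar y, x & q]);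
  ob_opp : forall s, P s -> ~ P (simplex_opp s);
  ob_C1 : forall e, e \in F -> exists2 s, P s & e \in map star s;
  ob_C3 : forall s x t, P (rcons s x) -> P t ->
    exists2 y, y \in t & P (rcons s y) \/ P (rcons s (bar y))
}.

Definition chi_of (P : seq (signed E) -> Prop) (s : seq (signed E)) : int :=
  if `[< P s >] then 1 else if `[< P (simplex_opp s) >] then -1 else 0.

Lemma chi_of1 P s : chi_of P s = 1 <-> P s.
Proof.
rewrite /chi_of; case: asboolP => [//|nP]; split=> [|/nP //].
by case: asboolP.
Qed.

Lemma chi_of_neq0 P s : chi_of P s != 0 <-> P s \/ P (simplex_opp s).
Proof.
rewrite /chi_of; case: asboolP => [h|nh]; first by split=> // _; left.
case: asboolP => [h|nh']; first by split=> // _; right.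
by split=> // -[/nh|/nh'].
Qed.

Lemma chi_of_oppE P s : (P s -> ~ P (simplex_opp s)) ->
  chi_of P (simplex_opp s) = - chi_of P s.
Proof.
rewrite /chi_of simplex_oppK => h.
case: asboolP => h1; case: asboolP => h2 //.
by case: (h h2).
Qed.

Lemma chi_of_ext P Q s t : (P s <-> Q t) ->
  (P (simplex_opp s) <-> Q (simplex_opp t)) -> chi_of P s = chi_of Q t.
Proof. by move=> /asbool_equiv_eq h1 /asbool_equiv_eq h2; rewrite /chi_of h1 h2. Qed.

(** The swap rule for [P] moves a bar from any place to the last one, so barring any element gives
    the opposite simplex; both sign rules follow. *)
Lemma chi_of_chirotope F r P : oriented_bases F r P ->
  (forall p x x' y1 y2, (size p).+2 = r ->
    0 <= chi_of P (p ++ [:: y1; x']) * chi_of P (p ++ [:: x; y2]) ->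
    0 <= chi_of P (p ++ [:: y2; x']) * chi_of P (p ++ [:: x; bar y1]) ->
    0 <= chi_of P (p ++ [:: x; x']) * chi_of P (p ++ [:: y1; y2])) ->
  chirotope_on F r (chi_of P).
Proof.
move=> H C4.
have sw2 p x y q : P (p ++ [:: x, y & q]) -> P (p ++ [:: bar x, bar y & q]).
  by move=> h; do 2!apply: (ob_swap H).
have bP p x q : P (p ++ bar x :: q) <-> P (simplex_opp (p ++ x :: q)).
  elim: q p x => [|y q IH] p x; first by rewrite !cats1 simplex_opp_rcons.
  have := IH (rcons p x) y; rewrite !cat_rcons => <-.
  by split=> /sw2; rewrite barK.
have br p x q : chi_of P (p ++ bar x :: q) = - chi_of P (p ++ x :: q).
  rewrite -chi_of_oppE; last exact: (ob_opp H).
  apply: chi_of_ext => //; rewrite -bP simplex_oppK; first by rewrite barK.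
split=> //.
- by move=> s; rewrite /chi_of; do 2!case: ifP => _ //.
- by move=> s /chi_of_neq0 [] /(ob_oriented H) //; rewrite oriented_opp.
- by move=> s /chi_of_neq0 [] /(ob_ground H) //; rewrite map_star_opp.
- by move=> e /(ob_C1 H) [s Ps es]; exists s => //; apply/chi_of_neq0; left.
- move=> p x y q.
  suff <- : chi_of P (p ++ [:: bar y, x & q]) = chi_of P (p ++ [:: x, y & q]).
    by rewrite br opprK.
  have eP u v q' : P (p ++ [:: bar u, v & q']) <-> P (p ++ [:: v, u & q']).
    split=> [|/(ob_swap H) //] h.
    by move/(ob_swap H)/(ob_swap H)/(ob_swap H): h; rewrite !barK.
  apply: chi_of_ext; first exact: eP.
  rewrite -!bP barK; apply: iff_sym; exact: eP.
- move=> s x t /chi_of_neq0 hs /chi_of_neq0 ht.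
  (* Either simplex is positive in one of its orientations, and passing to that one changes neither
     [s] nor the underlying elements of [t]. *)
  have [x1 hs1] : exists x1, P (rcons s x1).
    case: hs => [|]; first by exists x.
    by rewrite simplex_opp_rcons; exists (bar x).
  have [t1 ht1 tt1] : exists2 t1, P t1 & map star t1 = map star t.
    case: ht => h; [by exists t|exists (simplex_opp t) => //].
    exact: map_star_opp.
  have [y yt hy] := ob_C3 H hs1 ht1.
  have : star y \in map star t by rewrite -tt1 map_f.
  case/mapP => z zt eyz; exists z => //; apply/chi_of_neq0.
  rewrite simplex_opp_rcons.
  by case/star_eqP: eyz hy => ->; rewrite ?barK // => -[]; [right|left].
Qed.

End SignedIndices.

(** * Rank 2: positions on the circle *)

Section ZpVal.

Context (n : nat) (n_gt1 : (1 < n)%N).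
Implicit Types a b : 'Z_n.

Lemma Zp_ltn a : (val a < n)%N.
Proof. by have := ltn_ord a; rewrite [X in (_ < X)%N]Zp_cast. Qed.

Lemma Zp_valD a b : val (a + b) = ((val a + val b) %% n)%N.
Proof. by rewrite /=; congr (_ %% _)%N; exact: Zp_cast. Qed.

Lemma Zp_valN a : val (- a) = ((n - val a) %% n)%N.
Proof. by rewrite /=; congr ((_ - _) %% _)%N; exact: Zp_cast. Qed.

Lemma Zp_valB a b : val (b - a) = ((val b + (n - val a)) %% n)%N.
Proof. by rewrite Zp_valD Zp_valN modnDmr. Qed.

Lemma Zp_valBE a b :
  val (b - a) = (if val a <= val b then val b - val a else val b + n - val a)%N.
Proof.
rewrite Zp_valB; have := Zp_ltn a; have := Zp_ltn b.
move: (val a) (val b) => i j ltj lti; case: leqP => ij.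
  by rewrite (_ : j + (n - i) = (j - i) + n)%N ?modnDr ?modn_small; lia.
by rewrite modn_small; lia.
Qed.

Lemma Zp_val_nat k : (k < n)%N -> val (k%:R : 'Z_n) = k.
Proof.
by move=> ltk; rewrite -[LHS]/(nat_of_ord _) val_Zp_nat // modn_small.
Qed.

End ZpVal.

Lemma Zp_val_half k (a : 'Z_(k.*2)) : (0 < k)%N ->
  val (a + k%:R) = (if val a < k then val a + k else val a - k)%N.
Proof.
move=> k0; have gt1 : (1 < k.*2)%N by lia.
have lt := Zp_ltn gt1 a.
rewrite Zp_valD // Zp_val_nat //; last by lia.
move: (val a) lt => i lt; case: ltnP => ik; first by rewrite modn_small; lia.
by rewrite (_ : i + k = i - k + k.*2)%N ?modnDr ?modn_small; lia.
Qed.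

(* Atom j is met strictly less than half a turn after atom i; positions are
   taken in [0, 2k). *)
Definition precedes (k i j : nat) : bool :=
  ((i < j < i + k) || (j + k < i))%N.

Section RankTwo.

Context {E : finType}.
Implicit Types (x y : signed E) (F : {set E}) (Z : hseq2 E).

Lemma cyclic_order4_shift n (a b c d e : 'Z_n) :
  cyclic_order4 (a + e) (b + e) (c + e) (d + e) = cyclic_order4 a b c d.
Proof.
have sh u v : u + e - (v + e) = u - v :> 'Z_n.
  by rewrite opprD addrACA subrr addr0.
by rewrite /cyclic_order4 !sh.
Qed.

Lemma hseq2_posbase_shift Z c s :
  hseq2_posbase (hseq2_shift Z c) s <-> hseq2_posbase Z s.
Proof.
split=> -[x1 [x2 [-> ninc [a1 [a2 [a3 [a4 [h1 h2 h3 h4 cyc]]]]]]]];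
  exists x1, x2; split=> //.
- case=> a [i1 i2]; apply: ninc; exists (a - c : 'Z_((half_period Z).*2)).
  by rewrite /incident !ffunE subrK.
- exists (a1 + c), (a2 + c), (a3 + c), (a4 + c).
  by move: h1 h2 h3 h4; rewrite !ffunE cyclic_order4_shift.
- case=> a; rewrite /incident !ffunE => -[i1 i2]; apply: ninc.
  by exists (a + c).
- exists (a1 - c : 'Z_((half_period Z).*2)), (a2 - c), (a3 - c), (a4 - c).
  by rewrite !ffunE !subrK cyclic_order4_shift.
Qed.

Lemma cyclic_order4_opp n (a b c d : 'Z_n) :
  cyclic_order4 a b c d -> cyclic_order4 (- a) (- d) (- c) (- b).
Proof.
rewrite /cyclic_order4.
have valN (u : 'Z_n) : (0 < val u)%N -> val (- u) = ((Zp_trunc n).+2 - val u)%N.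
  by move=> u0; rewrite /= modn_small //; move: (ltn_ord u) u0 => /=; lia.
have sub u : - u - - a = - (u - a) :> 'Z_n by rewrite opprD.
rewrite !sub => /andP[/andP[b0 bc] cd].
have c0 := leq_ltn_trans (leq0n _) bc.
have d0 := leq_ltn_trans (leq0n _) cd.
rewrite !valN //.
have lt (u : 'Z_n) : (val u < (Zp_trunc n).+2)%N := ltn_ord u.
move: (val (b - a)) (val (c - a)) (val (d - a)) (lt (b - a)) (lt (c - a))
  (lt (d - a)) b0 bc cd => *.
by lia.
Qed.

Lemma hseq2_oppK : involutive (@hseq2_opp E).
Proof.
case=> k A; congr Hseq2; apply/ffunP => a.
by rewrite !ffunE opprK.
Qed.

(** The reflection [a |-> - a] reverses the cyclic order, so [x1, x2, bar x1, bar x2] turns into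
    [x1, bar x2, bar x1, x2]. *)
Lemma hseq2_posbase_opp Z s :
  hseq2_posbase (hseq2_opp Z) s <-> hseq2_posbase Z (simplex_opp s).
Proof.
have imp Z' s' :
    hseq2_posbase (hseq2_opp Z') s' -> hseq2_posbase Z' (simplex_opp s').
  case=> [x1 [x2 [-> ninc [a1 [a2 [a3 [a4 [h1 h2 h3 h4 cyc]]]]]]]].
  exists x1, (bar x2); split=> //.
    case=> a [i1 i2]; apply: ninc; exists (- a : 'Z_((half_period Z').*2)).
    by rewrite /incident !ffunE opprK; rewrite star_bar in i2.
  exists (- a1), (- a4), (- a3), (- a2).
  by move: h1 h2 h3 h4; rewrite !ffunE barK; split=> //; exact: cyclic_order4_opp.
split; first exact: imp.
by rewrite -{1}[Z]hseq2_oppK => /imp; rewrite simplex_oppK.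
Qed.

Lemma hseq2_eq_refl Z : hseq2_eq Z Z.
Proof.
exists 0; case: Z => k A; congr Hseq2.
by apply/ffunP => a; rewrite ffunE addr0.
Qed.

Lemma hseq2_eq_opp Z Z' :
  hseq2_eq Z Z' -> hseq2_eq (hseq2_opp Z) (hseq2_opp Z').
Proof.
case=> c ->; exists (- c : 'Z_((half_period Z).*2)); congr Hseq2.
by apply/ffunP => a; rewrite !ffunE opprD opprK.
Qed.

Lemma hseq2_eq_posbase Z Z' s :
  hseq2_eq Z Z' -> hseq2_posbase Z s <-> hseq2_posbase Z' s.
Proof. by case=> c ->; rewrite hseq2_posbase_shift. Qed.

Lemma is_hseq2_opp F Z : is_hseq2 F Z -> is_hseq2 F (hseq2_opp Z).
Proof.
case=> k2 at1 atk un dis; split=> //=.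
- by move=> a; rewrite ffunE; exact: at1.
- move=> a; rewrite !ffunE -atk opprD; congr (atom Z (_ + _)).
  (* Half a turn is its own opposite in [Z/2k]. *)
  apply/esym/eqP; rewrite -subr_eq0 opprK -natrD addnn.
  by apply/eqP/char_Zp; lia.
- rewrite -un (reindex_inj (@oppr_inj _)) /=.
  by apply: eq_bigr => a _; rewrite ffunE opprK.
- by move=> a b ab; rewrite !ffunE; apply: dis; rewrite eqr_opp.
Qed.

Section Positions.

Context {F : {set E}} {Z : hseq2 E} (hZ : is_hseq2 F Z).
Local Notation k := (half_period Z).

Lemma hseq2_period_gt1 : (1 < k.*2)%N.
Proof. by case: hZ => k2 *; lia. Qed.

Lemma atom_inj x a b : x \in atom Z a -> x \in atom Z b -> a = b.
Proof.
case: hZ => _ _ _ _ dis xa xb; apply/eqP/contraT => /dis.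
by move/disjointFr/(_ xa); rewrite xb.
Qed.

Lemma atom_bar x a : (bar x \in atom Z (a + k%:R)) = (x \in atom Z a).
Proof. by case: hZ => _ _ -> _ _; rewrite mem_barset barK. Qed.

Lemma atom_ex x : star x \in F -> exists a, x \in atom Z a.
Proof.
case: hZ => _ _ _ /setP/(_ x); rewrite inE => <- _ /bigcupP[a _ xa].
by exists a.
Qed.

Lemma atom_ground x a : x \in atom Z a -> star x \in F.
Proof.
case: hZ => _ _ _ /setP/(_ x); rewrite inE => <- _ xa.
by apply/bigcupP; exists a.
Qed.

Lemma val_atom_bar (a : 'Z_(k.*2)) : val (a + k%:R) =
  (if val a < k then val a + k else val a - k)%N.
Proof.
by apply: Zp_val_half; case: hZ => k2 *; lia.
Qed.

(** The bars lie half a turn after [x] and [y], so the cyclic order of the four atoms is decided by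
    whether [b] falls in the open half-circle after [a]. This excludes a common incident atom as
    well. *)
Lemma hseq2_posbaseP x y a b : x \in atom Z a -> y \in atom Z b ->
  hseq2_posbase Z [:: x; y] <-> precedes k (val a) (val b).
Proof.
move=> xa yb; have gt1 := hseq2_period_gt1.
have bxa : bar x \in atom Z (a + k%:R) by rewrite atom_bar.
have byb : bar y \in atom Z (b + k%:R) by rewrite atom_bar.
have la := Zp_ltn gt1 a; have lb := Zp_ltn gt1 b.
have va := val_atom_bar a; have vb := val_atom_bar b.
have cycE : cyclic_order4 a b (a + k%:R) (b + k%:R) = precedes k (val a) (val b).
  rewrite /cyclic_order4 /precedes !Zp_valBE // va vb.
  by move: (val a) (val b) la lb => i j *; do !case: ifP; lia.
split.
  case=> x1 [x2 [[<- <-] _ [a1 [a2 [a3 [a4 [h1 h2 h3 h4]]]]]]].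
  rewrite (atom_inj h1 xa) (atom_inj h2 yb) (atom_inj h3 bxa) (atom_inj h4 byb).
  by rewrite cycE.
move=> pr; exists x, y; split=> //; last first.
  by exists a, b, (a + k%:R), (b + k%:R); rewrite cycE.
case=> c; rewrite /incident !mem_starset_star => -[/orP h1 /orP h2].
have {}h1 : val c = val a \/ val c = val (a + k%:R).
  by case: h1 => h; [left|right]; congr val;
    [exact: atom_inj h xa|exact: atom_inj h bxa].
have {}h2 : val c = val b \/ val c = val (b + k%:R).
  by case: h2 => h; [left|right]; congr val;
    [exact: atom_inj h yb|exact: atom_inj h byb].
move: pr; rewrite /precedes; rewrite va in h1; rewrite vb in h2.
move: (val a) (val b) (val c) la lb h1 h2 => i j l la lb.
by do 2!case: ifP; lia.
Qed.

Lemma hseq2_posbase_atoms s : hseq2_posbase Z s ->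
  exists x y a b, [/\ s = [:: x; y], x \in atom Z a & y \in atom Z b].
Proof. by case=> x [y [-> _ [a [b [_ [_ [? ? _ _ _]]]]]]]; exists x, y, a, b. Qed.

End Positions.

End RankTwo.

(** * The sign map of a rank 2 hyperline sequence *)

Section RankTwoChirotope.

Context {E : finType}.
Implicit Types (x y : signed E) (F : {set E}) (Z : hseq2 E).

Definition precedes_sign (k i j : nat) : int :=
  if precedes k i j then 1 else if precedes k j i then -1 else 0.

(** The contrapositive of C4 for positions on a circle: the four disjuncts are exactly the ways in
    which one of the two products in the hypotheses of C4 can be negative. *)
Lemma precedes_crossing k i i' j1 j2 :
  (i < k.*2)%N -> (i' < k.*2)%N -> (j1 < k.*2)%N -> (j2 < k.*2)%N ->
  precedes k i i' -> precedes k j2 j1 ->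
  [|| precedes k j1 i' && precedes k j2 i, precedes k i' j1 && precedes k i j2,
      precedes k j2 i' && precedes k i j1 | precedes k i' j2 && precedes k j1 i].
Proof.
rewrite /precedes => li li' l1 l2.
move=> /orP[] h1 /orP[] h2.
all: case: (ltngtP i j1) => h3; case: (ltngtP i j2) => h4.
all: case: (ltngtP i' j1) => h5; case: (ltngtP i' j2) => h6.
all: lia.
Qed.

Lemma precedes_signN k i j : (i < k.*2)%N -> (j < k.*2)%N ->
  precedes_sign k j i = - precedes_sign k i j.
Proof.
rewrite /precedes_sign => li lj.
case: (boolP (precedes k i j)); case: (boolP (precedes k j i)) => //.
by rewrite /precedes; lia.
Qed.

Lemma precedes_sign1 k i j : precedes k i j -> precedes_sign k i j = 1.
Proof. by rewrite /precedes_sign => ->. Qed.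

Lemma precedes_sign_C4 k i i' j1 j2 :
  (i < k.*2)%N -> (i' < k.*2)%N -> (j1 < k.*2)%N -> (j2 < k.*2)%N ->
  0 <= precedes_sign k j1 i' * precedes_sign k i j2 ->
  0 <= precedes_sign k j2 i' * - precedes_sign k i j1 ->
  0 <= precedes_sign k i i' * precedes_sign k j1 j2.
Proof.
move=> li li' l1 l2 hA hB.
(* A negative product has sign pattern plus-minus or minus-plus; the second becomes the first on
   exchanging [i] with [i'] and [j1] with [j2]. *)
suff ncross u u' v w : precedes k u u' -> precedes k w v ->
    (u = i /\ u' = i' /\ v = j1 /\ w = j2) \/
    (u = i' /\ u' = i /\ v = j2 /\ w = j1) -> False.
  rewrite {1 2}/precedes_sign.
  case: ifP => [h1|h1]; [|case: ifP => [h2|h2]];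
    case: ifP => [h3|h3] //; try case: ifP => [h4|h4] //.
  - by case: (ncross i i' j1 j2 h1 h4); left.
  - by case: (ncross i' i j2 j1 h2 h3); right.
move=> h1 h2 e.
have /or4P : [|| precedes k j1 i' && precedes k j2 i,
    precedes k i' j1 && precedes k i j2,
    precedes k j2 i' && precedes k i j1 | precedes k i' j2 && precedes k j1 i].
  case: e h1 h2 => [[-> [-> [-> ->]]]|[-> [-> [-> ->]]]] h1 h2.
    exact: precedes_crossing.
  have := precedes_crossing li' li l2 l1 h1 h2.
  by case/or4P => /andP[-> ->]; rewrite ?orbT.
case=> /andP[/precedes_sign1 g1 /precedes_sign1 g2]; move: hA hB.
- by rewrite g1 (precedes_signN l2 li) g2.
- by rewrite (precedes_signN li' l1) g1 g2.
- by rewrite g1 g2.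
- by rewrite (precedes_signN li' l2) g1 (precedes_signN l1 li) g2.
Qed.

Lemma hseq2_chi_of F Z x y a b : is_hseq2 F Z ->
  x \in atom Z a -> y \in atom Z b ->
  chi_of (hseq2_posbase Z) [:: x; y] =
  precedes_sign (half_period Z) (val a) (val b).
Proof.
move=> hZ xa yb; have gt1 := hseq2_period_gt1 hZ.
have la := Zp_ltn gt1 a; have lb := Zp_ltn gt1 b.
have yb' : bar y \in atom Z (b + (half_period Z)%:R) by rewrite (atom_bar hZ).
rewrite /chi_of (asbool_equiv_eq (hseq2_posbaseP hZ xa yb)) asboolb.
rewrite (asbool_equiv_eq (hseq2_posbaseP hZ xa yb')) asboolb.
rewrite /precedes_sign (val_atom_bar hZ).
case: ifP => // _; congr (if _ then _ else _); rewrite /precedes.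
by move: (val a) (val b) la lb => i j la lb; case: ifP; lia.
Qed.

Lemma hseq2_oriented_bases F Z :
  is_hseq2 F Z -> oriented_bases F 2 (hseq2_posbase Z).
Proof.
move=> hZ; have gt1 := hseq2_period_gt1 hZ; split.
- move=> s /[dup] ps /hseq2_posbase_atoms[x [y [a [b [es xa yb]]]]].
  move: ps; rewrite es (hseq2_posbaseP hZ xa yb) => pr.
  rewrite /oriented /= inE andbT.
  have la := Zp_ltn gt1 a; have lb := Zp_ltn gt1 b.
  apply/eqP => /star_eqP[exy|exy].
    move: pr; rewrite exy in xa; rewrite (atom_inj hZ xa yb) /precedes.
    by move: (val b) => i; lia.
  rewrite exy -(atom_bar hZ) barK in xa; rewrite -(atom_inj hZ xa yb) in pr lb.
  move: pr lb; rewrite (val_atom_bar hZ) /precedes.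
  by move: (val a) la => i la; case: ifP; lia.
- move=> s /hseq2_posbase_atoms[x [y [a [b [-> xa yb]]]]] e.
  rewrite !inE => /orP[/eqP->|/eqP->]; first exact: (atom_ground hZ xa).
  exact: (atom_ground hZ yb).
- move=> p x y q /[dup] ps /hseq2_posbase_atoms[x1 [x2 [a [b []]]]].
  case: p ps => [|z1 [|z2 [|z3 p]]] // ps [ex ey eq] xa yb; rewrite /= ex ey eq in ps *.
  have yb' : bar x2 \in atom Z (b + (half_period Z)%:R) by rewrite (atom_bar hZ).
  move: ps; rewrite (hseq2_posbaseP hZ xa yb) (hseq2_posbaseP hZ yb' xa).
  rewrite (val_atom_bar hZ) /precedes; have := Zp_ltn gt1 a; have := Zp_ltn gt1 b.
  by move: (val a) (val b) => i j; case: ifP; lia.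
- move=> s /[dup] ps /hseq2_posbase_atoms[x [y [a [b [es xa yb]]]]].
  have yb' : bar y \in atom Z (b + (half_period Z)%:R) by rewrite (atom_bar hZ).
  move: ps; rewrite es /= (hseq2_posbaseP hZ xa yb) (hseq2_posbaseP hZ xa yb').
  rewrite (val_atom_bar hZ) /precedes; have := Zp_ltn gt1 a; have := Zp_ltn gt1 b.
  by move: (val a) (val b) => i j; case: ifP; lia.
- move=> e eF; have [a xa] := atom_ex (x := inl e) hZ eF.
  pose k := half_period Z.
  have k2 : (2 <= k)%N by case: hZ.
  have la := Zp_ltn gt1 a.
  (* The position right after that of [inl e], wrapping round at [2k]; it is less than half a turn
     away because [k >= 2]. *)
  pose i := (if (val a).+1 < k.*2 then (val a).+1 else 0)%N.
  have li : (i < k.*2)%N by rewrite /i; case: ifP; lia.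
  have [y yb] : exists y, y \in atom Z (i%:R).
    by case: hZ => _ /(_ i%:R)[/set0Pn[y yb] _ _] _ _ _; exists y.
  exists [:: inl e; y]; last by rewrite inE eqxx.
  rewrite (hseq2_posbaseP hZ xa yb) Zp_val_nat // /precedes /i.
  by move: (val a) la => j la; case: ifP; rewrite -/k; lia.
- move=> s x t /[dup] ps /hseq2_posbase_atoms[x1 [x2 [a [b [es xa _]]]]].
  move=> /[dup] pt /hseq2_posbase_atoms[y1 [y2 [c1 [c2 [et ya1 ya2]]]]].
  have [-> _] : s = [:: x1] /\ x = x2.
    by move: es; rewrite -[[:: x1; x2]]/(rcons [:: x1] x2) => /rcons_inj[].
  have yb1 : bar y1 \in atom Z (c1 + (half_period Z)%:R) by rewrite (atom_bar hZ).
  have yb2 : bar y2 \in atom Z (c2 + (half_period Z)%:R) by rewrite (atom_bar hZ).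
  rewrite /= et in pt *; move/(hseq2_posbaseP hZ ya1 ya2): pt => pt.
  (* [y1] and [y2] are on different diameters, so [x1] is off one of these; that element or its bar
     then lies in the open half-circle after [x1]. *)
  have [h|h] : (precedes (half_period Z) (val a) (val c1) \/
     precedes (half_period Z) (val a) (val (c1 + (half_period Z)%:R))) \/
     (precedes (half_period Z) (val a) (val c2) \/
     precedes (half_period Z) (val a) (val (c2 + (half_period Z)%:R))).
  + rewrite !(val_atom_bar hZ); move: pt; rewrite /precedes.
    have := Zp_ltn gt1 a; have := Zp_ltn gt1 c1; have := Zp_ltn gt1 c2.
    by move: (val a) (val c1) (val c2) => i j1 j2; do 2!case: ifP; lia.
  + exists y1; first by rewrite inE eqxx.
    by rewrite (hseq2_posbaseP hZ xa ya1) (hseq2_posbaseP hZ xa yb1).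
  + exists y2; first by rewrite !inE eqxx orbT.
    by rewrite (hseq2_posbaseP hZ xa ya2) (hseq2_posbaseP hZ xa yb2).
Qed.

Lemma hseq2_chirotope F Z :
  is_hseq2 F Z -> chirotope_on F 2 (chi_of (hseq2_posbase Z)).
Proof.
move=> hZ; have H := hseq2_oriented_bases hZ.
apply: chi_of_chirotope => // p x x' y1 y2; case: p => // _; rewrite !cat0s.
have gt1 := hseq2_period_gt1 hZ.
(* A pair with an element outside [F] has sign 0, so in C4 all four elements may be assumed to lie
   in atoms. *)
have zero u v : ~~ ((star u \in F) && (star v \in F)) ->
    chi_of (hseq2_posbase Z) [:: u; v] = 0.
  move=> nF; apply/eqP; apply: contraNT nF => /chi_of_neq0 [] /(ob_ground H) sF.
    by rewrite !sF // !inE eqxx ?orbT.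
  by rewrite map_star_opp in sF; rewrite !sF // !inE eqxx ?orbT.
have [|n1] := boolP ((star x \in F) && (star x' \in F)); last first.
  by rewrite (zero x x') // mul0r.
have [|n2] := boolP ((star y1 \in F) && (star y2 \in F)); last first.
  by rewrite (zero y1 y2) // mulr0.
move=> /andP[/(atom_ex hZ)[b1 yb1] /(atom_ex hZ)[b2 yb2]].
move=> /andP[/(atom_ex hZ)[a xa] /(atom_ex hZ)[a' xa']].
rewrite (_ : [:: x; bar y1] = simplex_opp [:: x; y1]) //.
rewrite chi_of_oppE; last exact: (ob_opp H).
rewrite (hseq2_chi_of hZ yb1 xa') (hseq2_chi_of hZ xa yb2).
rewrite (hseq2_chi_of hZ yb2 xa') (hseq2_chi_of hZ xa yb1).
rewrite (hseq2_chi_of hZ xa xa') (hseq2_chi_of hZ yb1 yb2).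
by apply: precedes_sign_C4; exact: Zp_ltn.
Qed.

End RankTwoChirotope.

(** * From hyperline sequences to chirotopes *)

Section AllRanks.

Context {E : finType}.
Implicit Types (F : {set E}) (s t u v : seq (signed E)).

Lemma take_drop_opp n s : size s = n.+2 ->
  take n (simplex_opp s) = take n s /\
  drop n (simplex_opp s) = simplex_opp (drop n s).
Proof.
move=> ss; rewrite -{1 3}(cat_take_drop n s).
have : size (drop n s) = 2%N by rewrite size_drop ss subSn // subSnn.
have st : size (take n s) = n by rewrite size_takel // ss; lia.
case: (drop n s) => // x v _; rewrite simplex_opp_cat.
by rewrite take_size_cat ?drop_size_cat.
Qed.

Lemma rd_eq_refl r (X : hseq E r) : rd_eq X X.
Proof.
elim/ltn_ind: r X => -[|[|[|q]]] IH X //; first exact: hseq2_eq_refl.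
by split=> Y Z XYZ; exists Y, Z; split=> //;
  [exact: IH|exact: hseq2_eq_refl|exact: IH|exact: hseq2_eq_refl].
Qed.

Lemma rd_eq_posbase r (X X' : hseq E r) s :
  rd_eq X X' -> hseq_posbase X s <-> hseq_posbase X' s.
Proof.
elim/ltn_ind: r X X' s => -[|[|[|q]]] IH X X' s //.
- by move->.
- exact: hseq2_eq_posbase.
case=> h1 h2; split=> -[os [Y [Z [XYZ pY pZ]]]]; split=> //.
- have [Y' [Z' [XYZ' eY eZ]]] := h1 _ _ XYZ; exists Y', Z'; split=> //.
    by apply/(IH q.+1 _ Y Y').
  by apply/(hseq2_eq_posbase _ eZ).
- have [Y' [Z' [XYZ' eY eZ]]] := h2 _ _ XYZ; exists Y', Z'; split=> //.
    by apply/(IH q.+1 _ Y' Y).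
  by apply/(hseq2_eq_posbase _ eZ).
Qed.

(** Above rank 2 both operations act on the final part only: [-X] negates the [Z] of each pair, and
    the opposite simplex bars the last element, which belongs to [Z]. *)
Lemma rd_posbase_opp r (X : hseq E r) s :
  hseq_posbase (rd_opp X : hseq E r) s <-> hseq_posbase X (simplex_opp s).
Proof.
case: r X => [|[|[|q]]] X //.
- split=> -[x xX]; first by move=> ->; exists (bar x); rewrite // -mem_barset.
  move=> e; exists (bar x); first by rewrite mem_barset barK.
  by rewrite -[s]simplex_oppK e.
- exact: hseq2_posbase_opp.
rewrite /hseq_posbase /= /hyperlines_posbase oriented_opp; split.
  case=> os [Y [_ [[Z XYZ ->] pY pZ]]]; split=> //; exists Y, Z.
  case/andP: os => /eqP/take_drop_opp[-> ->] _; split=> //.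
  exact/hseq2_posbase_opp.
case=> os [Y [Z [XYZ pY pZ]]]; split=> //; exists Y, (hseq2_opp Z).
case/andP: os pY pZ => /eqP/take_drop_opp[-> ->] _ pY pZ; split=> //.
  by exists Z.
exact/hseq2_posbase_opp.
Qed.

Lemma rd_eq_oppK r (X : hseq E r) : rd_eq X (rd_opp (rd_opp X) : hseq E r).
Proof.
case: r X => [|[|[|q]]] X //.
- by apply/setP => x; rewrite !mem_barset barK.
- by rewrite /= hseq2_oppK; exact: hseq2_eq_refl.
split=> [Y Z XYZ|Y _ [_ [Z XYZ ->] ->]]; exists Y, Z; split=> //.
- by exists (hseq2_opp Z); [exists Z|rewrite hseq2_oppK].
- exact: rd_eq_refl.
- exact: hseq2_eq_refl.
- exact: rd_eq_refl.
- by rewrite hseq2_oppK; exact: hseq2_eq_refl.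
Qed.

Lemma is_hseq1_star_inj F (X : {set signed E}) :
  is_hseq1 F X -> {in X &, injective star}.
Proof. by case=> _ /esym/eqP; move/imset_injP. Qed.

Lemma is_hseq1_bar F (X : {set signed E}) x :
  is_hseq1 F X -> x \in X -> bar x \notin X.
Proof.
move=> hX xX; apply/negP => bX.
have := is_hseq1_star_inj hX bX xX (star_bar x).
by apply/eqP/bar_neq.
Qed.

Lemma is_hseq1_opp F (X : {set signed E}) :
  is_hseq1 F X -> is_hseq1 F (barset X).
Proof.
case=> X0 cX eF; have sX : starset (barset X) = starset X.
  apply/setP => e; rewrite !mem_starset !mem_barset /= orbC //.
split; last by rewrite sX.
  by case/set0Pn: X0 => x xX; apply/set0Pn; exists (bar x); rewrite mem_barset barK.
rewrite sX -cX card_imset //; exact: inv_inj barK.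
Qed.

Lemma is_hseq_opp r F (X : hseq E r) :
  is_hseq F X -> is_hseq F (rd_opp X : hseq E r).
Proof.
case: r X => [|[|[|q]]] X //; [exact: is_hseq1_opp|exact: is_hseq2_opp|].
case=> ne H1 H2 H3 H4.
have opp s := @rd_posbase_opp q.+3 X s.
rewrite /hseq_posbase /= in opp.
split.
- by have [Y [Z XYZ]] := ne; exists Y, (hseq2_opp Z), Z.
- move=> Y _ [Z XYZ ->]; have [FY [FZ [hY hZ eF dis]]] := H1 _ _ XYZ.
  by exists FY, FZ; split=> //; exact: is_hseq2_opp.
- move=> Y1 _ Y2 _ FY2 s [Z1 XYZ1 ->] [Z2 XYZ2 ->] p1 hY2 sub.
  case: (H2 _ _ _ _ _ _ XYZ1 XYZ2 p1 hY2 sub) => -[eY eZ]; [left|right];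
    by split=> //; exact: hseq2_eq_opp.
- move=> s x t /opp; rewrite simplex_opp_rcons => ps /opp pt.
  have [y yt hy] := H3 _ _ _ ps pt.
  have : star y \in map star t by rewrite -map_star_opp map_f.
  case/mapP => z zt eyz; exists z => //; rewrite !opp !simplex_opp_rcons.
  by case/star_eqP: eyz hy => ->; rewrite ?barK // => -[]; [right|left].
- move=> p x y z.
  have e a b c : p ++ [:: a; b; c] = rcons (p ++ [:: a; b]) c.
    by rewrite -cats1 -catA.
  by rewrite !opp !e !simplex_opp_rcons -!e; exact: H4.
Qed.

Lemma hseq_ground_neq0 r F (X : hseq E r) : is_hseq F X -> F != set0.
Proof.
elim/ltn_ind: r F X => -[|[|[|q]]] IH F X //.
- case=> /set0Pn[x xX] _ <-; apply/set0Pn; exists (star x).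
  by rewrite mem_starset_star xX.
- move=> hX; case: (hX) => _ /(_ 0)[/set0Pn[x xX] _ _] _ _ _.
  by apply/set0Pn; exists (star x); exact: (atom_ground hX xX).
case=> -[Y [Z XYZ]] H1 _ _ _; have [FY [FZ [hY _ -> _]]] := H1 _ _ XYZ.
have /set0Pn[e eY] := IH q.+1 (ltnW (ltnSn _)) _ _ hY.
by apply/set0Pn; exists e; rewrite inE eY.
Qed.

Lemma hseq1_oriented_bases F (X : {set signed E}) :
  is_hseq1 F X -> oriented_bases F 1 (hseq1_posbase X).
Proof.
move=> hX; split.
- by move=> s [x _ ->].
- move=> s [x xX ->] e; rewrite !inE => /eqP ->.
  by case: hX => _ _ <-; rewrite mem_starset_star xX.
- by move=> [|a [|b p]] x y q [].
- move=> s [x xX ->] [y yX [exy]].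
  by move: (is_hseq1_bar hX xX); rewrite exy yX.
- case: hX => _ _ <- e /imsetP[x xX ->]; exists [:: x]; first by exists x.
  by rewrite inE eqxx.
- move=> s x t [z zX es] [y yX ->]; exists y; rewrite ?inE //.
  by left; exists y => //; case: s es => // a [].
Qed.

(** Only the base axioms of the lower-rank sequences [Y] enter the induction; C4 is inherited from
    the rank 2 sequences [Z]. *)
Theorem hseq_oriented_bases r F (X : hseq E r) : is_hseq F X ->
  oriented_bases F r (hseq_posbase X) /\
  chirotope_on F r (chi_of (hseq_posbase X)).
Proof.
elim/ltn_ind: r F X => -[|[|[|q]]] IH F X //.
- move=> hX; have H := hseq1_oriented_bases hX; split=> //.
  by apply: chi_of_chirotope H _ => p x x' y1 y2 [].
- move=> hX; split; first exact: hseq2_oriented_bases.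
  exact: hseq2_chirotope.
move=> hX; have {hX}[ne H1 H2 H3 H4] :
  @is_hyperlines E q.+1 (rank_datum E q.+1) F X := hX.
have {}IH FY (Y : hseq E q.+1) :
    is_hseq FY Y -> oriented_bases FY q.+1 (hseq_posbase Y).
  by move=> hY; have [] := IH q.+1 (ltnW (ltnSn _)) _ _ hY.
(* By H1 the two ground sets are disjoint, so juxtaposing a base of [Y] and one of [Z] always gives
   an oriented simplex. *)
have splitP s : hseq_posbase X s <-> exists (Y : hseq E q.+1) Z u v,
    [/\ s = u ++ v, X Y Z, hseq_posbase Y u & hseq2_posbase Z v].
  split=> [[_ [Y [Z [XYZ pY pZ]]]]|[Y [Z [u [v [-> XYZ pY pZ]]]]]].
    by exists Y, Z, (take q.+1 s), (drop q.+1 s); rewrite cat_take_drop.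
  have [FY [FZ [hY hZ _ dis]]] := H1 _ _ XYZ.
  have HY := IH _ _ hY; have HZ := hseq2_oriented_bases hZ.
  have /andP[/eqP su uu] := ob_oriented HY pY.
  have /andP[/eqP sv uv] := ob_oriented HZ pZ.
  split.
    rewrite /oriented size_cat su sv addn2 eqxx map_cat cat_uniq uu uv andbT /=.
    apply/hasPn => e /(ob_ground HZ pZ) eZ; apply/negP => /(ob_ground HY pY) eY.
    by move/disjointFr: dis => /(_ _ eY); rewrite eZ.
  by exists Y, Z; rewrite take_size_cat // drop_size_cat.
have posY FY (Y : hseq E q.+1) : is_hseq FY Y -> exists u, hseq_posbase Y u.
  move=> hY; have /set0Pn[e eY] := hseq_ground_neq0 hY.
  by have [u pu _] := ob_C1 (IH _ _ hY) eY; exists u.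
(* H2 leaves equal or opposite pairs; opposite ones would make [u] and its opposite both positive in
   [Y']. *)
have sameZ (Y : hseq E q.+1) Z (Y' : hseq E q.+1) Z' u v :
    X Y Z -> X Y' Z' -> hseq_posbase Y u -> hseq_posbase Y' u -> hseq2_posbase Z' v -> hseq2_posbase Z v.
  move=> XYZ XYZ' pY pY' pZ'.
  have [FY' [FZ' [hY' hZ' _ _]]] := H1 _ _ XYZ'.
  have := H2 _ _ _ _ _ _ XYZ XYZ' pY hY' (ob_ground (IH _ _ hY') pY').
  case=> -[eY eZ]; first by apply/(hseq2_eq_posbase _ eZ).
  have /(rd_posbase_opp Y') : hseq_posbase (rd_opp Y' : hseq E q.+1) u.
    exact/(rd_eq_posbase _ eY).
  by move/(ob_opp (IH _ _ hY') pY').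
have HX : oriented_bases F q.+3 (hseq_posbase X).
  split.
  - by move=> s [].
  - move=> s /splitP[Y [Z [u [v [-> XYZ pY pZ]]]]].
    have [FY [FZ [hY hZ -> _]]] := H1 _ _ XYZ => e.
    rewrite map_cat mem_cat inE => /orP[/(ob_ground (IH _ _ hY) pY) -> //|].
    by move=> /(ob_ground (hseq2_oriented_bases hZ) pZ) ->; rewrite orbT.
  (* The swapped places lie both in the [Z] part, or across the border, which is H4, or both in the
     [Y] part. *)
  - move=> p x y [|z [|z' q']].
    + case=> os [Y [Z [XYZ]]]; have sp : size p = q.+1.
        by case/andP: os => /eqP; rewrite size_cat /=; lia.
      rewrite take_size_cat // drop_size_cat // => pY pZ.
      have [FY [FZ [hY hZ _ _]]] := H1 _ _ XYZ.
      apply/splitP; exists Y, Z, p, [:: bar y; x]; split=> //.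
      exact: (ob_swap (hseq2_oriented_bases hZ) (p := [::])).
    + exact: H4.
    + case=> /andP[/eqP ss _] [Y [Z [XYZ pY pZ]]].
      (* The last two elements form the [Z] part, so just [m] of those behind the swapped pair
         belong to [Y]. *)
      pose m := (size q').
      have es a b : p ++ [:: a, b, z, z' & q'] =
          (p ++ [:: a, b & take m [:: z, z' & q']]) ++ drop m [:: z, z' & q'].
        by rewrite -catA /= cat_take_drop.
      have su a b :
          size (p ++ [:: a, b & take m [:: z, z' & q']]) = q.+1.
        have sm : size (take m [:: z, z' & q']) = m.
          by apply: size_takel; exact: leqW (leqnSn _).
        by move: ss; rewrite !size_cat [size (a :: _)]/= sm /= -/m; lia.
      move: pY pZ; rewrite es take_size_cat // drop_size_cat // => pY pZ.
      have [FY [FZ [hY hZ _ _]]] := H1 _ _ XYZ.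
      apply/splitP; exists Y, Z, (p ++ [:: bar y, x & take m [:: z, z' & q']]).
      exists (drop m [:: z, z' & q']); rewrite es; split=> //.
      exact: (ob_swap (IH _ _ hY)).
  - move=> s /splitP[Y [Z [u [v [-> XYZ pY pZ]]]]].
    have [FY [FZ [hY hZ _ _]]] := H1 _ _ XYZ.
    have HY := IH _ _ hY; have HZ := hseq2_oriented_bases hZ.
    have /andP[/eqP su _] := ob_oriented HY pY.
    case: v pZ => [|x v] pZ; first by have := ob_oriented HZ pZ.
    rewrite simplex_opp_cat => -[_ [Y' [Z' []]]].
    rewrite take_size_cat // drop_size_cat // => XYZ' pY' pZ'.
    exact: (ob_opp HZ pZ (sameZ _ _ _ _ _ _ XYZ XYZ' pY pY' pZ')).
  - move=> e; have [Y [Z XYZ]] := ne.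
    have [FY [FZ [hY hZ -> _]]] := H1 _ _ XYZ.
    have HY := IH _ _ hY; have HZ := hseq2_oriented_bases hZ.
    rewrite inE => /orP[eY|eZ].
      have [u pu eu] := ob_C1 HY eY.
      have /set0Pn[f fZ] : FZ != set0.
        exact: (@hseq_ground_neq0 2 FZ Z).
      have [v pv _] := ob_C1 HZ fZ.
      exists (u ++ v); last by rewrite map_cat mem_cat eu.
      by apply/splitP; exists Y, Z, u, v.
    have [v pv ev] := ob_C1 HZ eZ; have [u pu] := posY _ _ hY.
    exists (u ++ v); last by rewrite map_cat mem_cat ev orbT.
    by apply/splitP; exists Y, Z, u, v.
  - exact: H3.
split=> //; apply: chi_of_chirotope => // p x x' y1 y2 sp.
have {}sp : size p = q.+1 by lia.
(* If [p] is a base of some [Y], the matching [Z] gives all signs after [p]; otherwise the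
   conclusion has a vanishing factor. *)
have [[Y [Z [XYZ pY]]]|nY] := 
    pselect (exists (Y : hseq E q.+1) Z, X Y Z /\ hseq_posbase Y p).
  have [FY [FZ [hY hZ _ _]]] := H1 _ _ XYZ.
  have pE v : hseq_posbase X (p ++ v) <-> hseq2_posbase Z v.
    split=> [[_ [Y' [Z' []]]]|pZ]; last by apply/splitP; exists Y, Z, p, v.
    rewrite take_size_cat // drop_size_cat // => XYZ' pY' pZ'.
    exact: (sameZ _ _ _ _ _ _ XYZ XYZ' pY pY' pZ').
  have cE a b : chi_of (hseq_posbase X) (p ++ [:: a; b]) =
                chi_of (hseq2_posbase Z) [:: a; b].
    by apply: chi_of_ext; rewrite ?simplex_opp_cat pE.
  by rewrite !cE; exact: (cho_C4 (hseq2_chirotope hZ) (p := [::])).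
have -> : chi_of (hseq_posbase X) (p ++ [:: x; x']) = 0; last by rewrite mul0r.
apply/eqP; apply: contraPT nY => /chi_of_neq0 h.
have [v [_ [Y [Z []]]]] : exists v, hseq_posbase X (p ++ v).
  by rewrite simplex_opp_cat in h; case: h => h; eexists; exact: h.
by rewrite take_size_cat // => XYZ pY _; apply; exists Y, Z.
Qed.

End AllRanks.

(** * From chirotopes of rank 2 to hyperline sequences *)

Section SignForm.

Context {E : finType}.
Implicit Types (x y z : signed E) (c : signed E -> signed E -> int).

(** A chirotope with all but its last two entries fixed: an alternating form with signs as values,
    where C4 is the sign version of the three-term Grassmann-Pluecker relation. *)
Record sign_form c : Prop := SignForm {
  sf_range : forall x y, c x y \in [:: -1; 0; 1];
  sf_swap : forall x y, c y x = - c x y;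
  sf_bar : forall x y, c x (bar y) = - c x y;
  sf_C4 : forall x x' y1 y2, 0 <= c y1 x' * c x y2 ->
    0 <= c y2 x' * c x (bar y1) -> 0 <= c x x' * c y1 y2
}.

Lemma sf_barl c x y : sign_form c -> c (bar x) y = - c x y.
Proof. by move=> C; rewrite (sf_swap C y (bar x)) (sf_bar C) (sf_swap C y x). Qed.

Lemma sf_alt c x : sign_form c -> c x x = 0.
Proof.
move=> C; have := sf_range C x x; have := sf_swap C x x.
by rewrite !inE => e /or3P[] /eqP h; rewrite h in e *.
Qed.

(* The three-term relation when its term in c a a' vanishes. *)
Lemma sf_plucker0 c a a' y y' : sign_form c -> c a a' = 0 ->
  c a y * c a' y' = c a y' * c a' y.
Proof.
move=> C aa0.
(* C4 with [c a a'] as a factor of its first hypothesis, which thus reads [0 <= 0]. Barring [u]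
   reverses both inequalities, so the two products have the same sign and, being among -1, 0, 1, are
   equal. *)
have le0 u v : c a u * c a' v <= 0 -> c a v * c a' u <= 0.
  move=> h; have : 0 <= c u a' * c a v.
    apply: (sf_C4 C); first by rewrite aa0 mul0r.
    rewrite (sf_bar C) (sf_swap C a' v) (sf_swap C a u) opprK mulNr oppr_ge0.
    by rewrite mulrC.
  by rewrite (sf_swap C a' u) mulNr oppr_ge0 mulrC.
have ge0 u v : 0 <= c a u * c a' v -> 0 <= c a v * c a' u.
  by have := le0 (bar u) v; rewrite !(sf_bar C) mulNr mulrN !oppr_le0.
have rng u v : c a u * c a' v \in [:: -1; 0; 1].
  have := sf_range C a u; have := sf_range C a' v.
  by rewrite !inE => /or3P[] /eqP-> /or3P[] /eqP->.
move: (le0 y y') (ge0 y y') (le0 y' y) (ge0 y' y) (rng y y') (rng y' y).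
move: (c a y * c a' y') (c a y' * c a' y) => u v; rewrite !inE.
by move=> h1 h2 h3 h4 /or3P[] /eqP eu /or3P[] /eqP ev; move: h1 h2 h3 h4;
  rewrite eu ev; lia.
Qed.

Lemma chirotope_sign_form (F : {set E}) r chi p :
  chirotope_on F r chi -> (size p).+2 = r ->
  sign_form (fun x y => chi (p ++ [:: x; y])).
Proof.
move=> H sp; split.
- by move=> x y; exact: cho_range H _.
- by move=> x y; exact: (cho_swap H).
- by move=> x y; rewrite -[[:: x; bar y]]/([:: x] ++ [:: bar y]) catA (cho_bar H) -catA.
- by move=> x x' y1 y2; exact: (cho_C4 H).
Qed.

End SignForm.

Section RankTwoConverse.

Context {E : finType} {F : {set E}} {c : signed E -> signed E -> int}.
Context (C : sign_form c).
Context (c_ground : forall x y, c x y != 0 -> star x \in F).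
Context (c_C1 : forall x, star x \in F -> exists y, c x y != 0).
Implicit Types x y z : signed E.

(** All elements outside [F] have the zero row and form one class of their own, which the
    assumptions [star x \in F] keep out. *)
Definition codir x y : bool := [forall z, c x z == c y z].

Lemma codirP x y : reflect (forall z, c x z = c y z) (codir x y).
Proof. exact: 'forall_eqP. Qed.

Lemma codirxx x : codir x x.
Proof. exact/codirP. Qed.

Lemma codir_sym x y : codir x y = codir y x.
Proof. by apply/codirP/codirP. Qed.

Lemma codir_trans y x z : codir x y -> codir y z -> codir x z.
Proof. by move=> /codirP h1 /codirP h2; apply/codirP => u; rewrite h1. Qed.

Lemma codir_bar x y : codir (bar x) y = codir x (bar y).
Proof.
apply/codirP/codirP => h z; have := h z; rewrite !(sf_barl _ _ C).
  by move=> <-; rewrite opprK.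
by move=> ->; rewrite opprK.
Qed.

Lemma codir_c x x' y y' : codir x x' -> codir y y' -> c x y = c x' y'.
Proof.
move=> /codirP h1 /codirP h2.
by rewrite h1 (sf_swap C y x') h2 (sf_swap C x' y') opprK.
Qed.

Lemma codir_c0 x y : codir x y -> c x y = 0.
Proof. by move/codirP->; exact: sf_alt. Qed.

Lemma codir_ground x y : codir x y -> star x \in F -> star y \in F.
Proof. by move=> /codirP h /c_C1[z]; rewrite h; exact: c_ground. Qed.

Lemma codir_barN x : star x \in F -> ~~ codir x (bar x).
Proof.
move=> /c_C1[z nz]; apply/codirP => /(_ z); rewrite (sf_barl _ _ C) => e.
by move: nz; have := sf_range C x z; rewrite !inE => /or3P[] /eqP h; rewrite h in e *.
Qed.

(** By [sf_plucker0] the rows of [x] and [y] are proportional; both being nonzero with entries in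
    -1, 0, 1, the ratio is a sign. *)
Lemma c0_codir x y : star x \in F -> star y \in F -> c x y = 0 ->
  codir x y || codir x (bar y).
Proof.
move=> /c_C1[u xu] /c_C1[v yv] xy0.
have prop z := sf_plucker0 z v C xy0.
have xv : c x v != 0.
  by apply: contraNneq xu => xv0; have /eqP := prop u;
     rewrite xv0 mul0r mulf_eq0 (negPf yv) orbF.
have := sf_range C x v; have := sf_range C y v.
rewrite !inE (negPf xv) (negPf yv) /= => /orP[]/eqP eyv /orP[]/eqP exv;
  move: prop; rewrite eyv exv => prop; apply/orP.
- by left; apply/codirP => z; have := prop z; rewrite mulrN1 mulN1r => /oppr_inj.
- right; apply/codirP => z; rewrite (sf_barl _ _ C); have := prop z.
  by rewrite mulrN1 mul1r => <-; rewrite opprK.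
- right; apply/codirP => z; rewrite (sf_barl _ _ C); have := prop z.
  by rewrite mulr1 mulN1r.
- by left; apply/codirP => z; have := prop z; rewrite mulr1 mul1r.
Qed.

(** * Sorting the directions of a half-plane *)

Section HalfPlane.

Context (x0 : signed E) (x0F : star x0 \in F).

(** Half-open: the boundary direction of [x0] is in and that of [bar x0] is out, so that exactly one
    of [x] and [bar x] is taken for each [x] over [F]. *)
Definition half_plane : pred (signed E) :=
  fun x => (star x \in F) && ((c x0 x == 1) || codir x0 x).

Lemma half_plane_or x : star x \in F -> half_plane x || half_plane (bar x).
Proof.
move=> xF; rewrite /half_plane star_bar xF /= (sf_bar C).
have := sf_range C x0 x; rewrite !inE => /or3P[] /eqP h.
- by rewrite h opprK eqxx orbT.
- by case/orP: (c0_codir x0F xF h) => ->; rewrite ?orbT.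
- by rewrite h eqxx.
Qed.

Lemma half_plane_codir x y : codir x y -> half_plane x -> half_plane y.
Proof.
move=> xy /andP[xF h]; rewrite /half_plane (codir_ground xy xF) /=.
rewrite -(codir_c (codirxx x0) xy); case/orP: h => [-> //|h].
by rewrite (codir_trans h xy) orbT.
Qed.

Lemma half_plane_barN x : half_plane x -> ~~ half_plane (bar x).
Proof.
move=> /andP[xF h]; rewrite /half_plane star_bar xF /= (sf_bar C).
have nx := codir_barN xF.
apply/negP => /orP[] h'; case/orP: h => h.
- by move: h'; rewrite (eqP h).
- by move: h'; rewrite (codir_c0 h) oppr0.
- have := codir_c0 h'; rewrite (sf_bar C) (eqP h).
  by [].
- by move/negP: nx; apply; apply: codir_trans h'; rewrite codir_sym.
Qed.

Lemma half_plane_ge0 x : half_plane x -> 0 <= c x0 x.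
Proof. by case/andP=> _ /orP[/eqP-> //|/codir_c0 ->]. Qed.

Lemma half_plane_c0 x y :
  half_plane x -> half_plane y -> c x y = 0 -> codir x y.
Proof.
move=> hx hy xy0; case/andP: (hx) => xF _; case/andP: (hy) => yF _.
case/orP: (c0_codir xF yF xy0) => // xby.
by have := half_plane_barN hy; rewrite (half_plane_codir xby hx).
Qed.

Definition le_half x y : bool := 0 <= c x y.

Lemma le_half_total : {in half_plane &, total le_half}.
Proof.
move=> x y _ _; rewrite /le_half (sf_swap C x y) oppr_ge0.
exact: le_total.
Qed.

(** Around the full circle this relation is cyclic; in the half-plane, C4 with [x0] as fourth point
    gives [0 <= c x z * c x0 y]. *)
Lemma le_half_trans : {in half_plane & &, transitive le_half}.
Proof.
move=> y x z hy hx hz; rewrite /le_half => xy yz.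
have [xy0|xyn0] := eqVneq (c x y) 0.
  by rewrite (codir_c (half_plane_c0 hx hy xy0) (codirxx z)).
have [yz0|yzn0] := eqVneq (c y z) 0.
  rewrite -(codir_c (codirxx x) (half_plane_c0 hy hz yz0)) //.
have : 0 <= c x z * c x0 y.
  apply: (sf_C4 C); first by rewrite mulr_ge0 // half_plane_ge0.
  by rewrite (sf_bar C) -(sf_swap C) mulr_ge0 // half_plane_ge0.
(* Here [c x0 y] is 1 unless [y] points along [x0]; in that case [0 <= c y x], against
   [0 < c x y]. *)
case/andP: (hy) => yF /orP[/eqP->|/codirP x0y]; first by rewrite mulr1.
have := half_plane_ge0 hx; rewrite x0y (sf_swap C x y) oppr_ge0 => yx.
by case/eqP: xyn0; apply/eqP; rewrite eq_le yx xy.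
Qed.

(** [pick] depends only on the predicate, so codirectional elements receive the same
    representative. *)
Definition direction x : signed E := odflt x [pick y | codir x y].

Lemma codir_direction x : codir x (direction x).
Proof. by rewrite /direction; case: pickP => [//|/(_ x)]; rewrite codirxx. Qed.

Lemma direction_eq x y : codir x y -> direction x = direction y.
Proof.
move=> xy; have eq : codir x =1 codir y.
  move=> z; apply/idP/idP; apply: codir_trans => //.
  by rewrite codir_sym.
rewrite /direction (eq_pick eq); case: pickP => // /(_ y).
by rewrite codirxx.
Qed.

Definition half_list : seq (signed E) :=
  sort le_half [seq x <- enum {: signed E} | half_plane x && (direction x == x)].

Lemma mem_half_list x :
  (x \in half_list) = half_plane x && (direction x == x).
Proof. by rewrite mem_sort mem_filter mem_enum andbT. Qed.

Lemma half_list_sorted i j : (i < j < size half_list)%N ->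
  c (nth x0 half_list i) (nth x0 half_list j) = 1.
Proof.
case/andP => ij jk; have ik := ltn_trans ij jk.
have ul : uniq half_list by rewrite sort_uniq filter_uniq // enum_uniq.
have hl x : x \in half_list -> half_plane x by rewrite mem_half_list => /andP[].
have al : all half_plane [seq x <- enum {: signed E} |
    half_plane x && (direction x == x)].
  by apply/allP => x; rewrite mem_filter => /andP[/andP[]].
have al' : all half_plane half_list by apply/allP => x /hl.
have := sort_sorted_in le_half_total al.
rewrite (sorted_pairwise_in le_half_trans al') => /(pairwiseP x0).
move=> /(_ i j ik jk ij); rewrite /le_half.
set x := nth _ _ i; set y := nth _ _ j => xy.
have xl : x \in half_list by exact: mem_nth.
have yl : y \in half_list by exact: mem_nth.
have : c x y != 0.
  apply/eqP => /(half_plane_c0 (hl _ xl) (hl _ yl)) /direction_eq.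
  move: xl yl; rewrite !mem_half_list => /andP[_ /eqP->] /andP[_ /eqP->] /eqP.
  by rewrite nth_uniq // (ltn_eqF ij).
have := sf_range C x y; rewrite !inE => /or3P[] /eqP // h; last by rewrite h eqxx.
by move: xy; rewrite h.
Qed.

(** Indices stand for positions on the full circle: the opposite of a direction is half a turn, that
    is [k] places, further on. *)
Definition turn i : signed E :=
  if (i < size half_list)%N then nth x0 half_list i
  else bar (nth x0 half_list (i - size half_list)).

Local Notation k := (size half_list).

Lemma c_turn i j : (i < k.*2)%N -> (j < k.*2)%N ->
  c (turn i) (turn j) = precedes_sign k i j.
Proof.
have base i' j' : (i' < k)%N -> (j' < k)%N ->
    c (nth x0 half_list i') (nth x0 half_list j') =
    if (i' < j')%N then 1 else if (j' < i')%N then -1 else 0.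
  move=> li lj; case: ltngtP => ij.
  - by rewrite half_list_sorted // ij.
  - by rewrite (sf_swap C) half_list_sorted // ij.
  - by rewrite ij; exact: sf_alt.
move=> li lj; rewrite /turn /precedes_sign /precedes.
case: ifP => ik; case: ifP => jk; rewrite ?(sf_bar C) ?(sf_barl _ _ C) base; try lia.
all: by do !case: ifP; lia.
Qed.

Lemma turn_ground i : (i < k.*2)%N -> star (turn i) \in F.
Proof.
have base j : (j < k)%N -> star (nth x0 half_list j) \in F.
  by move=> /(mem_nth x0); rewrite mem_half_list => /andP[/andP[]].
by move=> li; rewrite /turn; case: ifP => ik; rewrite ?star_bar base //; lia.
Qed.

Lemma turn_ex x : star x \in F -> exists2 i, (i < k.*2)%N & codir (turn i) x.
Proof.
have base y : half_plane y ->
    exists2 i, (i < k)%N & codir (nth x0 half_list i) y.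
  move=> hy; have dy : direction y \in half_list.
    rewrite mem_half_list (half_plane_codir (codir_direction y) hy) /=.
    by apply/eqP/esym/direction_eq/codir_direction.
  exists (index (direction y) half_list); first by rewrite index_mem.
  by rewrite nth_index // codir_sym codir_direction.
move=> xF; case/orP: (half_plane_or xF) => /base[i ik h].
  by exists i; [lia|rewrite /turn ik].
exists (i + k)%N; first by lia.
by rewrite /turn ifN ?addnK ?codir_bar // -leqNgt leq_addl.
Qed.

Lemma turn_half i : (i < k.*2)%N ->
  turn (if i < k then i + k else i - k)%N = bar (turn i).
Proof.
rewrite /turn => li; case: (ltnP i k) => ik.
  by rewrite ifN ?addnK // -leqNgt leq_addl.
by rewrite ifT ?barK //; lia.
Qed.

Lemma turn_inj i j : (i < k.*2)%N -> (j < k.*2)%N ->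
  codir (turn i) (turn j) -> i = j.
Proof.
move=> li lj h; have := codir_c0 h; rewrite c_turn // => pr.
(* A zero sign means equal or opposite positions, and opposite ones are not codirectional. *)
have [//|ej] : i = j \/ j = (if i < k then i + k else i - k)%N.
  move: pr; rewrite /precedes_sign /precedes.
  by do !case: ifP; lia.
by move: h; rewrite ej turn_half // (negPf (codir_barN (turn_ground li))).
Qed.

Definition hseq2_of_form : hseq2 E := @Hseq2 E k
  [ffun a : 'Z_(k.*2) => [set y | codir (turn (val a)) y]].

(** With a single diameter any two positions are equal or opposite and the form would vanish, which
    C1 at [x0] forbids. *)
Lemma size_half_list_gt1 : (1 < k)%N.
Proof.
have [z xz] := c_C1 x0F.
have zF : star z \in F by apply: (@c_ground _ x0); rewrite (sf_swap C) oppr_eq0.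
have [i li hi] := turn_ex x0F; have [j lj hj] := turn_ex zF.
move: xz; rewrite -(codir_c hi hj) c_turn // /precedes_sign /precedes.
by do !case: ifP; lia.
Qed.

Lemma mem_hseq2_of_form x a :
  (x \in atom hseq2_of_form a) = codir (turn (val a)) x.
Proof. by rewrite ffunE inE. Qed.

Lemma is_hseq2_of_form : is_hseq2 F hseq2_of_form.
Proof.
have k1 := size_half_list_gt1; have gt1 : (1 < k.*2)%N by lia.
have la (a : 'Z_(k.*2)) := Zp_ltn gt1 a.
split=> //.
- move=> a; split=> //.
    by apply/set0Pn; exists (turn (val a)); rewrite mem_hseq2_of_form codirxx.
  rewrite /starset card_in_imset // => x y; rewrite !mem_hseq2_of_form => hx hy.
  case/star_eqP => // exy; rewrite exy in hx.
  have yF := codir_ground hy (turn_ground (la a)).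
  have /negP[] := codir_barN yF.
  by apply: codir_trans hx; rewrite codir_sym.
- move=> a; apply/setP => x; rewrite mem_barset !mem_hseq2_of_form.
  rewrite Zp_val_half ?(ltnW k1) // turn_half; last exact: la.
  by rewrite codir_bar.
- apply/setP => x; rewrite inE; apply/bigcupP/idP => [[a _]|xF].
    by rewrite mem_hseq2_of_form => /codir_ground; apply; exact: turn_ground.
  have [i li hi] := turn_ex xF; exists (i%:R) => //.
  by rewrite mem_hseq2_of_form Zp_val_nat.
- move=> a b ab; apply/pred0P => x /=; apply/negP => /andP[].
  rewrite !mem_hseq2_of_form => ha; rewrite codir_sym => hb.
  case/eqP: ab; apply: val_inj; apply: turn_inj (codir_trans ha hb); exact: la.
Qed.

Lemma hseq2_of_form_posbase x y :
  hseq2_posbase hseq2_of_form [:: x; y] <-> c x y = 1.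
Proof.
have hZ := is_hseq2_of_form.
have gt1 : (1 < k.*2)%N by have := size_half_list_gt1; lia.
have la (a : 'Z_(k.*2)) := Zp_ltn gt1 a.
have key a b : x \in atom hseq2_of_form a -> y \in atom hseq2_of_form b ->
    hseq2_posbase hseq2_of_form [:: x; y] <-> c x y = 1.
  move=> xa yb; rewrite (hseq2_posbaseP hZ xa yb).
  move: xa yb; rewrite !mem_hseq2_of_form => xa yb.
  rewrite -(codir_c xa yb) c_turn; [|exact: la|exact: la].
  rewrite /precedes_sign; case: ifP => //; case: ifP => //.
split=> [|xy].
  move=> /[dup] ps /hseq2_posbase_atoms[x1 [y1 [a [b [[ex ey] xa yb]]]]].
  by rewrite -ex in xa; rewrite -ey in yb; apply/(key _ _ xa yb).
have xF : star x \in F by apply: (@c_ground _ y); rewrite xy.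
have yF : star y \in F by apply: (@c_ground _ x); rewrite (sf_swap C) xy.
have [a xa] := atom_ex hZ xF; have [b yb] := atom_ex hZ yF.
exact/(key _ _ xa yb).
Qed.

End HalfPlane.

End RankTwoConverse.

Lemma chirotope2_hseq2 {E : finType} (F : {set E}) chi : F != set0 ->
  chirotope_on F 2 chi ->
  exists2 Z : hseq2 E, is_hseq2 F Z &
    forall s, hseq2_posbase Z s <-> chi s = 1.
Proof.
case/set0Pn => e0 e0F H.
have C := chirotope_sign_form (p := [::]) H (erefl _).
set c := (fun x y => _) in C; rewrite /= in @c C.
have cg x y : c x y != 0 -> star x \in F.
  by move=> /(cho_ground H); apply; rewrite inE eqxx.
have c1 x : star x \in F -> exists y, c x y != 0.
  move=> /(cho_C1 H)[s sn0 xs]; have := cho_oriented H sn0.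
  case: s sn0 xs => [|u [|v []]] // sn0 xs _.
  move: xs; rewrite !inE => /orP[] /eqP /star_eqP[] ->.
  - by exists v.
  - by exists v; rewrite (sf_barl _ _ C) oppr_eq0.
  - by exists u; rewrite (sf_swap C) oppr_eq0.
  - by exists u; rewrite (sf_barl _ _ C) (sf_swap C) opprK.
have hZ := is_hseq2_of_form C cg c1 (x0 := inl e0) e0F.
exists (hseq2_of_form (c := c) (F := F) (inl e0)) => // s.
split=> [/[dup] ps /hseq2_posbase_atoms[x [y [a [b [es _ _]]]]]|cs].
  by rewrite es in ps *; exact/(hseq2_of_form_posbase C cg c1 (x0 := inl e0)).
have : oriented 2 s by apply: (cho_oriented H); rewrite cs.
case: s cs => [|u [|v []]] // cs _.
exact/(hseq2_of_form_posbase C cg c1 (x0 := inl e0)).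
Qed.

(** * Flats of codimension 2 *)

Section Flats.

Context {E : finType} {F : {set E}} {n : nat} {chi : seq (signed E) -> int}.
Context (H : chirotope_on F n.+2 chi).
Implicit Types (x y z u v : signed E) (b s t p : seq (signed E)).

Definition independent b : Prop := exists z1 z2, chi (b ++ [:: z1; z2]) != 0.

(** The closure of an independent [b] in the underlying matroid. Testing [inl e] suffices, as bars
    only change the sign. *)
Definition flat b : {set E} :=
  [set e in F | [forall z, chi (b ++ [:: inl e; z]) == 0]].

Lemma flatP b x : reflect (star x \in F /\ forall z, chi (b ++ [:: x; z]) = 0)
  (star x \in flat b).
Proof.
rewrite inE; apply: (iffP andP) => -[xF h]; split=> //.
  move=> z; have /eqP := forallP h z.
  by case: (star_inlP x) => [-> //|->]; rewrite (cho_bar H) => ->.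
apply/forallP => z; have /eqP := h z; case: x {h xF} => e //.
by rewrite -[inr e]/(bar (inl e)) (cho_bar H) oppr_eq0.
Qed.

Lemma chi_swap_neq0 p x y :
  (chi (p ++ [:: y; x]) != 0) = (chi (p ++ [:: x; y]) != 0).
Proof. by rewrite (cho_swap H) oppr_eq0. Qed.

Lemma chi_flatN b x y : chi (b ++ [:: x; y]) != 0 ->
  star x \notin flat b /\ star y \notin flat b.
Proof.
have half u v : chi (b ++ [:: u; v]) != 0 -> star u \notin flat b.
  by apply: contra => /flatP[_ ->].
by move=> h; split; [exact: half h|apply: (half y x); rewrite chi_swap_neq0].
Qed.

Lemma chi_neq0_uniq s : chi s != 0 -> uniq (map star s).
Proof. by move/(cho_oriented H)/andP=> []. Qed.

Lemma chi_star_neq p x y : chi (p ++ [:: x; y]) != 0 -> star x != star y.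
Proof.
by move/chi_neq0_uniq; rewrite map_cat cat_uniq /= inE => /and3P[_ _ /andP[]].
Qed.

Lemma chi_catN s t e : chi (s ++ t) != 0 ->
  e \in map star s -> e \in map star t -> False.
Proof.
move/chi_neq0_uniq; rewrite map_cat cat_uniq => /and3P[_ /hasPn h _] es et.
by have := h _ et; rewrite /= es.
Qed.

Lemma size_independent b : independent b -> size b = n.
Proof.
case=> z1 [z2 /(cho_oriented H)/andP[/eqP]]; rewrite size_cat /=.
by lia.
Qed.

Lemma sub_flat b : independent b -> {subset map star b <= flat b}.
Proof.
move=> [z1 [z2 h]] e /mapP[x xb ->]; apply/flatP; split.
  by apply: (cho_ground H h); rewrite map_cat mem_cat map_f.
move=> z; apply/eqP/contraT => nz.
by case: (chi_catN nz (map_f star xb)); rewrite inE eqxx.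
Qed.

(** C3 exchanges the last place only, so it is applied twice with a swap in between. *)
Lemma independent_extend b t : independent b -> chi t != 0 ->
  exists f g, [/\ f \in t, g \in t & chi (b ++ [:: f; g]) != 0].
Proof.
move=> [z1 [z2 h]] ht.
have ex u v : chi (b ++ [:: u; v]) != 0 ->
    exists2 g, g \in t & chi (b ++ [:: u; g]) != 0.
  rewrite -[[:: u; v]]/(rcons [:: u] v) -rcons_cat => h1.
  have [g gt hg] := cho_C3 H h1 ht; exists g => //.
  by rewrite -[[:: u; g]]/(rcons [:: u] g) -rcons_cat.
have [g gt] := ex _ _ h; rewrite chi_swap_neq0 => /ex[f ft hf].
by exists g, f.
Qed.

Lemma pair_in u v f g p w : f \in [:: u; v] -> g \in [:: u; v] ->
  chi (p ++ [:: f; g]) != 0 ->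
  (chi (w ++ [:: f; g]) != 0) = (chi (w ++ [:: u; v]) != 0).
Proof.
rewrite !inE => /orP[]/eqP-> /orP[]/eqP-> // h.
- by have := chi_star_neq h; rewrite eqxx.
- exact: chi_swap_neq0.
- by have := chi_star_neq h; rewrite eqxx.
Qed.

(** Elements that complete [b] to a base lie outside [flat b], hence outside [s]; taken from [s ++
    [:: u; v]] they must be [u] and [v]. *)
Lemma flat_neq0 b s u v : independent b -> independent s ->
  {subset map star s <= flat b} ->
  (chi (s ++ [:: u; v]) != 0) = (chi (b ++ [:: u; v]) != 0).
Proof.
move=> ib is_ sb.
have tail w f g : chi (b ++ [:: f; g]) != 0 ->
    f \in s ++ w -> g \in s ++ w -> f \in w /\ g \in w.
  move=> h; have [nf ng] := chi_flatN h.
  rewrite !mem_cat => /orP[/(map_f star)/sb|fw]; first by rewrite (negPf nf).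
  by move=> /orP[/(map_f star)/sb|]; first by rewrite (negPf ng).
apply/idP/idP => h.
  have [f [g [ft gt hfg]]] := independent_extend ib h.
  have [fw gw] := tail _ _ _ hfg ft gt.
  by rewrite -(pair_in _ fw gw hfg).
(* Conversely [s] is completed from [b ++ [:: u; v]] by [f] and [g]; completing [b] from [s ++
   [:: f; g]] shows that these lie outside the flat, so they are [u] and [v]. *)
have [f [g [ft gt hfg]]] := independent_extend is_ h.
have [f' [g' [ft' gt' hfg']]] := independent_extend ib hfg.
have [fw gw] := tail _ _ _ hfg' ft' gt'.
have {}hfg' : chi (b ++ [:: f; g]) != 0 by rewrite -(pair_in _ fw gw hfg').
have [nf ng] := chi_flatN hfg'.
have {}ft : f \in [:: u; v].
  by move: ft; rewrite mem_cat => /orP[/(map_f star)/(sub_flat ib)|//]; rewrite (negPf nf).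
have {}gt : g \in [:: u; v].
  by move: gt; rewrite mem_cat => /orP[/(map_f star)/(sub_flat ib)|//]; rewrite (negPf ng).
by rewrite -(pair_in _ ft gt hfg).
Qed.

Lemma flat_eq b s : independent b -> independent s ->
  {subset map star s <= flat b} -> flat s = flat b.
Proof.
move=> ib is_ sb; apply/setP => e; rewrite !inE; congr (_ && _).
apply: eq_forallb => z; apply: negb_inj.
exact: flat_neq0.
Qed.

(** A base contains two elements outside the flat, those that complete [b], and here only [z] can be
    one. *)
Lemma flat_dependent b p x y z : independent b ->
  {subset map star (p ++ [:: x; y]) <= flat b} -> chi (p ++ [:: x; y; z]) = 0.
Proof.
move=> ib sb; apply/eqP/contraT => h.
have [f [g [ft gt hfg]]] := independent_extend ib h.
have [nf ng] := chi_flatN hfg.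
have only w : w \in p ++ [:: x; y; z] -> star w \notin flat b -> w = z.
  rewrite -[[:: x; y; z]]/([:: x; y] ++ [:: z]) catA mem_cat.
  by case/orP => [/(map_f star)/sb -> //|]; rewrite inE => /eqP.
by have := chi_star_neq hfg; rewrite (only f) // (only g) // eqxx.
Qed.

(* Replacing one element of a basis of a flat rescales the contraction by a
   sign: the three-term relation has a vanishing term, so the ratio at [z; y]
   does not depend on y. *)
Lemma sign_eq_exchange b p a a' : independent b ->
  independent (rcons p a) -> independent (rcons p a') ->
  {subset map star (p ++ [:: a; a']) <= flat b} ->
  sign_eq chi (rcons p a) (rcons p a').
Proof.
move=> ib ia ia' sb.
pose f x y := chi (rcons p a ++ [:: x; y]).
pose g x y := chi (rcons p a' ++ [:: x; y]).
have sp : (size (rcons p a)).+2 = n.+2 by rewrite (size_independent ia).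
(* With [p] and [z] fixed, the pair [a], [a'] has sign 0, since [p], [a], [a'] together are [n + 1]
   elements of a flat of rank [n]. *)
have plucker z y y' : f z y * g z y' = f z y' * g z y.
  have sz : (size (rcons p z)).+2 = n.+2 by rewrite -sp !size_rcons.
  have := sf_plucker0 y y' (chirotope_sign_form H sz) (a := a) (a' := a').
  rewrite /f /g !cat_rcons !(cho_swap H p _ z) !mulrNN; apply.
  rewrite -[[:: a, z & _]]/([:: a] ++ [:: z; a']) catA (cho_swap H) -catA /=.
  by rewrite (flat_dependent _ ib sb) !oppr0.
have fg x y : (f x y != 0) = (g x y != 0).
  apply: flat_neq0 => // e; rewrite -cats1 map_cat mem_cat => h.
  rewrite (flat_eq ib ia'); last first.
    move=> e'; rewrite -cats1 map_cat mem_cat => h'; apply: sb.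
    rewrite map_cat mem_cat /= !inE; move: h'; rewrite /= !inE.
    by move=> /orP[] ->; rewrite ?orbT.
  apply: sb; rewrite map_cat mem_cat /= !inE.
  by move: h; rewrite /= !inE => /orP[] ->; rewrite ?orbT.
have swf x y : f y x = - f x y by exact: (cho_swap H).
have swg x y : g y x = - g x y by exact: (cho_swap H).
(* Where [f] and [g] do not vanish, [q] is their ratio; [plucker] makes it independent of the second
   entry. *)
pose q x y := f x y * g x y.
have qsym x y : q y x = q x y by rewrite /q swf swg mulrNN.
have pm x y : f x y != 0 -> (f x y = 1 \/ f x y = -1) /\ (g x y = 1 \/ g x y = -1).
  move=> h; have := h; rewrite fg => h'.
  have := cho_range H (rcons p a ++ [:: x; y]).
  have := cho_range H (rcons p a' ++ [:: x; y]).
  rewrite -/(f x y) -/(g x y) !inE (negPf h) (negPf h') /=.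
  by move=> /orP[]/eqP-> /orP[]/eqP->; split; auto.
have qeq z y y' : f z y != 0 -> f z y' != 0 -> q z y = q z y'.
  move=> /pm[e1 e2] /pm[e3 e4]; move: (plucker z y y'); rewrite /q.
  by case: e1 => ->; case: e2 => ->; case: e3 => ->; case: e4 => ->.
have [u [v fuv]] := ia; rewrite -/(f u v) in fuv.
(* Any nonzero pair is linked to [u], [v] by exchanges: C3 replaces [y] by some [w] among [u] and
   [v], then [x] gives way to the other one. *)
have const x y : f x y != 0 -> q x y = q u v.
  move=> fxy.
  have [w wt fxw] : exists2 w, w \in [:: u; v] & f x w != 0.
    have := fxy; rewrite /f -[[:: x; y]]/(rcons [:: x] y) -rcons_cat => h.
    have [w wt hw] := cho_C3 H h fuv.
    rewrite rcons_cat /= -/(f x w) in hw; exists w => //.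
    move: wt; rewrite mem_cat => /orP[/(map_f star) wa|//].
    by case: (chi_catN hw wa); rewrite !inE eqxx orbT.
  rewrite (qeq x y w) // qsym.
  have fwx : f w x != 0 by rewrite swf oppr_eq0.
  move: wt; rewrite !inE => /orP[]/eqP ew; subst w; first exact: qeq.
  by rewrite [RHS]qsym; apply: qeq => //; rewrite swf oppr_eq0.
have fE x y : f x y = q u v * g x y.
  have [f0|fn0] := eqVneq (f x y) 0.
    by move: (fg x y); rewrite f0 eqxx => /esym/negbFE/eqP->; rewrite mulr0.
  rewrite -(const _ _ fn0) /q -mulrA.
  by have [_ []] := pm _ _ fn0 => ->; rewrite ?mulrNN !mulr1.
have wE : (forall x y, f x y = g x y) \/ (forall x y, f x y = - g x y).
  have [[]h1 []h2] := pm _ _ fuv; move: fE; rewrite /q h1 h2 => fE;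
    [left|right|right|left] => x y; by rewrite fE ?mulrNN ?mulr1 ?mul1r ?mulN1r.
(* Continuations of length other than 2 give 0 on both sides. *)
have sw s' w : size s' = size (rcons p a) -> size w != 2%N -> chi (s' ++ w) = 0.
  move=> ss; apply: contraNeq => /(cho_oriented H)/andP[/eqP + _].
  by rewrite size_cat ss -sp -addn2 => /addnI ->.
have sa' : size (rcons p a') = size (rcons p a) by rewrite !size_rcons.
case: wE => h; [left|right] => w; have [sw2|nw] := boolP (size w == 2%N);
  try by rewrite !sw // oppr0.
  by case: w sw2 => [|x [|y []]] // _; exact: h.
by case: w sw2 => [|x [|y []]] // _; exact: h.
Qed.

(** Induction on the number of elements of [s] not in [b], each of which is exchanged for one of
    [b]. When none is left, [s] is [b] up to order and bars. *)
Lemma flat_sign_eq b s : independent b -> independent s ->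
  {subset map star s <= flat b} -> sign_eq chi s b.
Proof.
move=> ib; have [m] := ubnP (count (fun x => star x \notin map star b) s).
elim: m s => // m IH s lem is_ sb.
have [/hasP[x xs xb]|/hasPn nos] :=
  boolP (has (fun x => star x \notin map star b) s); last first.
  apply: (sign_eq_perm_star H).
  have us : uniq (map star s).
    by case: is_ => ? [? /chi_neq0_uniq]; rewrite map_cat cat_uniq => /and3P[].
  have ub : uniq (map star b).
    by case: ib => ? [? /chi_neq0_uniq]; rewrite map_cat cat_uniq => /and3P[].
  apply: uniq_perm => //.
  have [] := uniq_min_size us (s2 := map star b).
  - by move=> e /mapP[y ys ->]; have := nos _ ys; rewrite negbK.
  - by rewrite !size_map !size_independent.
  - by [].
pose s0 := rem x s.
have ps : perm_eq s (rcons s0 x) by rewrite perm_sym perm_rcons perm_sym perm_to_rem.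
have es : sign_eq chi s (rcons s0 x).
  by apply: (sign_eq_perm_star H); exact: perm_map.
have [z1 [z2 hz]] := is_.
have hb : chi (b ++ [:: z1; z2]) != 0 by rewrite -(flat_neq0 z1 z2 ib is_ sb).
(* With [z1] and [z2] in front, C3 acts on [x]; the new element comes from [b], because repeating
   [z1] or [z2] would leave no simplex. *)
have hz' : chi (rcons [:: z1, z2 & s0] x) != 0.
  by move: hz; rewrite (sign_eq_neq0 _ es) (chi_move2 _ _ _ _ H) cats0.
have [y] := cho_C3 H hz' hb; rewrite mem_cat => yt hy.
have yb : y \in b.
  case/orP: yt => // yz; exfalso.
  move: hy; rewrite -cats1 -[[:: z1, z2 & s0] ++ _]/([:: z1; z2] ++ (s0 ++ [:: y])) => hy.
  by apply: (chi_catN hy (map_f star yz)); rewrite map_f // mem_cat inE eqxx orbT.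
have is' : independent (rcons s0 y).
  exists z1, z2; rewrite (chi_move2 _ _ _ _ H) cats0; exact: hy.
have s0b : {subset map star s0 <= flat b}.
  by move=> e /mapP[u us ->]; apply: sb; apply: map_f; exact: mem_rem us.
have yF : star y \in flat b by apply: (sub_flat ib); exact: map_f.
have xF : star x \in flat b by apply: sb; exact: map_f.
apply: (sign_eq_trans es).
apply: (@sign_eq_trans _ _ (rcons s0 y)).
  apply: (sign_eq_exchange ib) => //.
    by exists z1, z2; rewrite -(sign_eq_neq0 _ es).
  move=> e; rewrite map_cat mem_cat => /orP[/s0b //|].
  by rewrite in_cons mem_seq1 => /orP[]/eqP->.
apply: IH => //.
  move: lem; rewrite (permP ps) -!cats1 !count_cat /= xb (map_f star yb) /=; lia.
by move=> e; rewrite map_rcons mem_rcons in_cons => /orP[/eqP->|/s0b].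
Qed.

(** * Contraction and restriction at a flat *)

Lemma contraction_chirotope b : independent b ->
  chirotope_on (F :\: flat b) 2 (fun t => chi (b ++ t)).
Proof.
move=> ib; have sb := size_independent ib.
have ori t : chi (b ++ t) != 0 -> oriented 2 t.
  move=> /(cho_oriented H)/andP[]; rewrite size_cat sb -addn2 eqn_add2l => st.
  by rewrite map_cat cat_uniq => /and3P[_ _ ut]; rewrite /oriented st ut.
split=> //.
- by move=> t; exact: cho_range H _.
- move=> t h e et; rewrite inE (cho_ground H h) ?map_cat ?mem_cat ?et ?orbT //.
  rewrite andbT; have := ori _ h; case: t h et => [|x [|y []]] // h et _.
  have [nx ny] := chi_flatN h.
  by move: et; rewrite in_cons mem_seq1 => /orP[]/eqP->.
- move=> e; rewrite inE => /andP[ne eF].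
  have [z hz] : exists z, chi (b ++ [:: inl e; z]) != 0.
    by move: ne; rewrite inE eF /= => /forallPn.
  by exists [:: inl e; z]; rewrite // inE eqxx.
- by move=> p x q; rewrite !catA (cho_bar H).
- by move=> p x y q; rewrite !catA (cho_swap H).
- move=> s x t; rewrite -!rcons_cat => hs ht.
  have [y] := cho_C3 H hs ht; rewrite mem_cat => /orP[yb|yt] hy; last first.
    by exists y; rewrite -?rcons_cat.
  exfalso; rewrite rcons_cat in hy; apply: (chi_catN hy (map_f star yb)).
  by rewrite map_f // mem_rcons inE eqxx.
- by move=> [|//] x x' y1 y2 _; apply: (cho_C4 H); rewrite sb.
Qed.

(** The cut-off confines the support to [L]: [z1] and [z2] may also complete simplices that leave
    the flat. *)
Definition restriction (L : {set E}) z1 z2 s : int :=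
  if all (mem L) (map star s) then chi (s ++ [:: z1; z2]) else 0.

Lemma restriction_neq0 (L : {set E}) z1 z2 s : restriction L z1 z2 s != 0 ->
  {subset map star s <= L} /\ chi (s ++ [:: z1; z2]) != 0.
Proof. by rewrite /restriction; case: allP => //; rewrite ?eqxx. Qed.

Lemma restrictionE (L : {set E}) z1 z2 s : {subset map star s <= L} ->
  restriction L z1 z2 s = chi (s ++ [:: z1; z2]).
Proof. by rewrite /restriction => /allP->. Qed.

(** C1 is the main point: a base through [e] has its other elements replaced by those of [b ++
    [:: z1; z2]]; then [z1] and [z2] must occur, and the rest is a basis of the flat. *)
Lemma restriction_chirotope b z1 z2 : chi (b ++ [:: z1; z2]) != 0 ->
  chirotope_on (flat b) n (restriction (flat b) z1 z2).
Proof.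
move=> hb; have ib : independent b by exists z1, z2.
split.
- by move=> s; rewrite /restriction; case: ifP => // _; exact: cho_range H _.
- move=> s /restriction_neq0[_ /(cho_oriented H)/andP[]].
  rewrite size_cat addn2 !eqSS => ss; rewrite map_cat cat_uniq => /and3P[us _ _].
  by rewrite /oriented ss us.
- by move=> s /restriction_neq0[].
- move=> e eL; have eF : e \in F by move: eL; rewrite inE => /andP[].
  have [eb|neb] := boolP (e \in map star b).
    by exists b => //; rewrite restrictionE //; exact: sub_flat.
  have [s0 hs0 es0] := cho_C1 H eF.
  pose D := b ++ [:: z1; z2].
  have [x ex] : exists x : signed E, star x = e by exists (inl e).
  (* C3 trades the last element for one of [D], which is then moved to the front, until nothing of
     [p] is left. *)
  have grow p q : chi (x :: q ++ p) != 0 -> {subset q <= D} ->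
      exists2 q', chi (x :: q') != 0 & {subset q' <= D}.
    elim/last_ind: p q => [|p y IH] q; first by rewrite cats0; exists q.
    rewrite -rcons_cat -rcons_cons => h qD.
    have [z zD hz] := cho_C3 H h hb.
    apply: (IH (z :: q)); last by move=> u; rewrite inE => /orP[/eqP->|/qD].
    apply: chi_neq0_perm_star H _ hz; apply: perm_map.
    by rewrite /= perm_cons perm_rcons.
  have [p hp] : exists p, chi (x :: p) != 0.
    case/mapP: es0 => y ys ey; exists (rem y s0).
    apply: chi_neq0_perm_star H _ hs0; rewrite /= ex ey.
    exact: (perm_map star (perm_to_rem ys)).
  have [q hq qD] := grow p [::] hp (fun _ => ltac:(by [])).
  have uq := chi_neq0_uniq hq.
  have uq' : uniq q by move: uq => /= /andP[_ /map_uniq].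
  have sq : size q = n.+1.
    by have /andP[/eqP] := cho_oriented H hq; rewrite /= => -[].
  have sb := size_independent ib.
  (* Without [z], the list [q] would be [b] and [z'] in some order, making [b], [x], [z'] a base
     although [x] lies in the flat. *)
  have miss z z' : perm_eq [:: z1; z2] [:: z; z'] -> z \in q.
    move=> pz; apply: contraT => nz.
    have pD : perm_eq D (b ++ [:: z; z']) by rewrite perm_cat2l.
    have sub : {subset q <= rcons b z'}.
      move=> u uq0; have := qD u uq0; rewrite (perm_mem pD) mem_cat mem_rcons !inE.
      by case/or3P => [->|/eqP eu|->]; rewrite ?orbT //; move: nz; rewrite -eu uq0.
    have [] := uniq_min_size uq' sub; first by rewrite size_rcons sb sq.
    move=> _ eqm; have pq : perm_eq q (rcons b z').
      apply: uniq_perm => //; have := chi_neq0_uniq hb.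
      rewrite -/D (perm_uniq (perm_map star pD)) => /map_uniq.
      rewrite cat_uniq rcons_uniq => /and3P[-> h _]; rewrite andbT.
      by apply: contra h => h; rewrite /= h orbT.
    have : chi (b ++ [:: x; z']) != 0.
      apply: chi_neq0_perm_star H _ hq; apply: perm_map.
      apply: (@perm_trans _ (x :: rcons b z')); first by rewrite perm_cons.
      by rewrite -cats1 -[x :: _]/([:: x] ++ b ++ [:: z']) perm_catCA.
    by case/chi_flatN; rewrite ex eL.
  have z1q : z1 \in q by apply: (miss z1 z2).
  have z2q : z2 \in q.
    by apply: (miss z2 z1); rewrite -[[:: z1; z2]]/([:: z1] ++ [:: z2]) perm_catC.
  have z12 := chi_star_neq hb.
  pose q0 := rem z2 (rem z1 q).
  have z2q' : z2 \in rem z1 q.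
    by rewrite mem_rem_uniq // !inE z2q andbT; apply: contraNneq z12 => ->.
  have pq : perm_eq q (q0 ++ [:: z1; z2]).
    rewrite perm_sym perm_catC perm_sym.
    apply: (perm_trans (perm_to_rem z1q)); rewrite perm_cons.
    exact: perm_to_rem.
  exists (x :: q0); last by rewrite inE ex eqxx.
  rewrite restrictionE; last first.
    move=> e'; rewrite in_cons ex => /orP[/eqP-> //|/mapP[u uq0 ->]].
    have : u \in D by apply: qD; rewrite (perm_mem pq) mem_cat uq0.
    rewrite mem_cat => /orP[ub|uz]; first by apply: (sub_flat ib); exact: map_f.
    move: uq; rewrite /= (perm_uniq (perm_map star pq)) map_cat cat_uniq.
    by case/and4P=> _ _ /hasPn/(_ _ (map_f star uz)); rewrite /= map_f.
  apply: chi_neq0_perm_star H _ hq; apply: perm_map.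
  by rewrite /= perm_cons.
- move=> p x q; rewrite /restriction !map_cat /= star_bar.
  by case: ifP; rewrite ?oppr0 // -!catA (cho_bar H).
- move=> p x y q; have e : all (mem (flat b)) (map star (p ++ [:: y, x & q])) =
      all (mem (flat b)) (map star (p ++ [:: x, y & q])).
    by rewrite !map_cat !all_cat /=; congr (_ && _); exact: andbCA.
  rewrite /restriction e.
  by case: ifP; rewrite ?oppr0 // -!catA (cho_swap H).
- move=> s x t /restriction_neq0[sL hs] /restriction_neq0[tL ht].
  have hs' : chi (rcons [:: z1, z2 & s] x) != 0.
    by move: hs; rewrite (chi_move2 _ _ _ _ H) cats0.
  have [y] := cho_C3 H hs' ht; rewrite mem_cat => /orP[yt|yz] hy.
    exists y => //; rewrite restrictionE.
      by rewrite (chi_move2 _ _ _ _ H) cats0.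
    move=> e; rewrite map_rcons mem_rcons in_cons => /orP[/eqP->|es].
      by apply: tL; exact: map_f.
    by apply: sL; rewrite map_rcons mem_rcons inE es orbT.
  exfalso; rewrite rcons_cons rcons_cons in hy.
  apply: (@chi_catN [:: z1; z2] (rcons s y) (star y)) => //; first exact: map_f.
  by rewrite map_f // mem_rcons inE eqxx.
- move=> p x x' y1 y2 sp.
  (* If some entry leaves the flat, the product in the conclusion is 0; otherwise [z1] and [z2] move
     to the front and C4 for [chi] applies. *)
  have [/allP aL|nL] := boolP
    (all (mem (flat b)) (map star (p ++ [:: x; x'; y1; y2]))); last first.
    suff -> : restriction (flat b) z1 z2 (p ++ [:: x; x']) *
              restriction (flat b) z1 z2 (p ++ [:: y1; y2]) = 0 by [].
    apply/eqP; apply: contraNT nL; rewrite mulf_eq0 negb_or => /andP[].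
    move=> /restriction_neq0[h1 _] /restriction_neq0[h2 _].
    apply/allP => e; rewrite -[[:: x; x'; y1; y2]]/([:: x; x'] ++ [:: y1; y2]).
    rewrite catA map_cat mem_cat => /orP[/h1 //|ey]; apply: h2.
    by rewrite map_cat mem_cat ey orbT.
  have rE u v : u \in [:: x; x'; y1; y2; bar y1] -> v \in [:: x; x'; y1; y2; bar y1] ->
      restriction (flat b) z1 z2 (p ++ [:: u; v]) = chi ([:: z1, z2 & p] ++ [:: u; v]).
    have inL w : w \in [:: x; x'; y1; y2; bar y1] -> star w \in flat b.
      move=> ws; apply: aL; rewrite map_cat mem_cat /= !inE.
      by move: ws; rewrite !inE => /or4P[|||/orP[]] /eqP ->; rewrite ?star_bar eqxx ?orbT.
    move=> /inL us /inL vs; rewrite restrictionE.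
      by rewrite (chi_move2 z1 z2 (p ++ [:: u; v]) [::] H) cats0.
    move=> e; rewrite map_cat mem_cat => /orP[ep|].
      by apply: aL; rewrite map_cat mem_cat ep.
    by rewrite in_cons mem_seq1 => /orP[]/eqP->.
  rewrite !rE ?inE ?eqxx ?orbT //; apply: (cho_C4 H).
  by rewrite /= sp.
Qed.

End Flats.

(** * From chirotopes to hyperline sequences *)

Section Converse.

Context {E : finType}.
Implicit Types (F L : {set E}) (s t : seq (signed E)).

Lemma chirotope1_hseq1 F chi : F != set0 -> chirotope_on F 1 chi ->
  exists X : {set signed E}, is_hseq1 F X /\
    forall s, hseq1_posbase X s <-> chi s = 1.
Proof.
case/set0Pn => e0 e0F H.
have bar1 x : chi [:: bar x] = - chi [:: x] by exact: (cho_bar H [::] x [::]).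
have nz e : e \in F -> chi [:: inl e] != 0.
  move=> /(cho_C1 H)[s sn0 es]; apply: (chi_neq0_perm_star H) (sn0).
  have := cho_oriented H sn0; case: s es {sn0} => [|x []] //.
  by rewrite inE => /eqP ->.
pose X := [set x | chi [:: x] == 1].
have sX : starset X = F.
  apply/setP => e; rewrite mem_starset !inE -[inr e]/(bar (inl e)) bar1.
  apply/idP/idP => [h|/nz].
    apply: (cho_ground H (s := [:: inl e])); last by rewrite inE eqxx.
    by case/orP: h => /eqP h; [rewrite h|rewrite -oppr_eq0 h].
  have [] := chi_cases [:: inl e] H => ->; by rewrite ?eqxx ?opprK ?eqxx ?orbT.
exists X; split.
  split=> //; last first.
    rewrite /starset card_in_imset // => x y; rewrite !inE => /eqP hx /eqP hy.
    by case/star_eqP => // exy; move: hx; rewrite exy bar1 hy.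
  move: e0F; rewrite -sX => /imsetP[x xX _]; by apply/set0Pn; exists x.
move=> s; split=> [[x xX ->]|cs]; first by move: xX; rewrite inE => /eqP.
have : oriented 1 s by apply: (cho_oriented H); rewrite cs.
case: s cs => [|x []] // cs _; exists x => //.
by rewrite inE cs.
Qed.

Section HigherRank.

Context {F : {set E}} {q : nat} {chi : seq (signed E) -> int}.
Context (H : chirotope_on F q.+3 chi).
Local Notation n := q.+1.
Local Notation independent := (@independent E chi).
Local Notation flat := (@flat E F chi).

Lemma sign_eq_flat s s' : sign_eq chi s s' -> independent s ->
  independent s' /\ flat s' = flat s.
Proof.
move=> ss' [z1 [z2 h]]; split.
  by exists z1, z2; rewrite -(sign_eq_neq0 _ ss').
apply/setP => e; rewrite !inE; congr (_ && _); apply: eq_forallb => z.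
by apply: negb_inj; rewrite (sign_eq_neq0 _ ss').
Qed.

Definition is_flat L : Prop := exists2 s, independent s & flat s = L.

(** By the last clause, for each ordered basis [s] of [L], [s ++ t] is positive exactly if [t] has
    in [Z] the orientation that [s] has in [Y]. Hence the pair may be replaced by its opposite. *)
Definition hyperline L (Y : hseq E n) (Z : hseq2 E) : Prop :=
  [/\ is_hseq L Y, is_hseq2 (F :\: L) Z,
      forall s, hseq_posbase Y s -> independent s /\ flat s = L
    & forall s, independent s -> flat s = L ->
      (hseq_posbase Y s /\ forall t, hseq2_posbase Z t <-> chi (s ++ t) = 1) \/
      (hseq_posbase Y (simplex_opp s) /\
       forall t, hseq2_posbase Z (simplex_opp t) <-> chi (s ++ t) = 1)].

Lemma hyperline_opp L Y Z : hyperline L Y Z ->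
  hyperline L (rd_opp Y : hseq E n) (hseq2_opp Z).
Proof.
case=> hY hZ Yflat YZ; split.
- exact: is_hseq_opp.
- exact: is_hseq2_opp.
- move=> s /rd_posbase_opp/Yflat[is_ eL].
  have ss : sign_eq chi (simplex_opp s) s.
    by apply: (sign_eq_perm_star H); rewrite map_star_opp.
  by have [? ->] := sign_eq_flat ss is_.
- move=> s is_ eL; case: (YZ s is_ eL) => -[Ys Zt]; [right|left]; split.
  + by apply/rd_posbase_opp; rewrite simplex_oppK.
  + by move=> t; rewrite hseq2_posbase_opp simplex_oppK.
  + exact/rd_posbase_opp.
  + by move=> t; rewrite hseq2_posbase_opp.
Qed.

(** [Y] comes from the restriction to the flat and [Z] from the contraction of a basis [b]; by
    [flat_sign_eq], passing to another basis changes both signs together. *)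
Lemma hyperline_ex L :
  (forall F' chi', F' != set0 -> chirotope_on F' n chi' ->
    exists X : hseq E n, is_hseq F' X /\
      forall s, hseq_posbase X s <-> chi' s = 1) ->
  is_flat L -> exists Y Z, hyperline L Y Z.
Proof.
move=> IH [b ib <-].
(* Normalized to sign 1, so that [b] itself becomes positive in [Y]. *)
have [z1 [z2 hz]] : exists z1 z2, chi (b ++ [:: z1; z2]) = 1.
  have [z1 [z2 hz]] := ib.
  have [h|h|h] := chi_cases (b ++ [:: z1; z2]) H.
  - exists z1, (bar z2); rewrite -[[:: z1; bar z2]]/([:: z1] ++ [:: bar z2]).
    by rewrite catA (cho_bar H) -catA h opprK.
  - by rewrite h in hz.
  - by exists z1, z2.
have hz0 : chi (b ++ [:: z1; z2]) != 0 by rewrite hz.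
have HY := restriction_chirotope H hz0; have HZ := contraction_chirotope H ib.
have sb := size_independent H ib.
have flat0 : flat b != set0.
  case: b sb {ib hz hz0 HY HZ} (sub_flat H ib) => // x b _ sub.
  by apply/set0Pn; exists (star x); apply: sub; rewrite inE eqxx.
have Z0 : F :\: flat b != set0.
  have [nz1 _] := chi_flatN H hz0; apply/set0Pn; exists (star z1).
  rewrite in_setD nz1; apply: (cho_ground H hz0).
  by rewrite map_cat mem_cat /= inE eqxx orbT.
have [Y [hY Ys]] := IH _ _ flat0 HY.
have [Z hZ Zs] := chirotope2_hseq2 Z0 HZ.
exists Y, Z; split=> //.
- move=> s /Ys cs.
  have /restriction_neq0[sL hs] : restriction (flat b) z1 z2 s (chi := chi) != 0.
    by rewrite cs.
  have is_ : independent s by exists z1, z2.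
  by split=> //; exact: (flat_eq H).
move=> s is_ eL.
have sL : {subset map star s <= flat b} by rewrite -eL; exact: (sub_flat H).
have [h|h] := flat_sign_eq H ib is_ sL; [left|right]; split.
- by apply/Ys; rewrite restrictionE // h.
- by move=> t; rewrite Zs h.
- by apply/Ys; rewrite (chi_opp _ _ HY) // restrictionE // h hz opprK.
- by move=> t; rewrite Zs (chi_opp _ _ HZ) // h.
Qed.

Lemma chirotope_hyperlines :
  F != set0 ->
  (forall F' chi', F' != set0 -> chirotope_on F' n chi' ->
    exists X : hseq E n, is_hseq F' X /\
      forall s, hseq_posbase X s <-> chi' s = 1) ->
  exists X : hseq E q.+3, is_hseq F X /\
    forall s, hseq_posbase X s <-> chi s = 1.
Proof.
case/set0Pn => e0 e0F IH.
(* One pair is chosen per flat, and only it and its opposite enter [X], so that H2 holds for pairs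
   over one flat by construction. The option covers sets that are not flats. *)
have /choice[f hf] : forall L, exists o : option (hseq E n * hseq2 E),
    is_flat L -> exists Y Z, o = Some (Y, Z) /\ hyperline L Y Z.
  move=> L; have [fL|nfL] := pselect (is_flat L); last by exists None.
  have [Y [Z YZ]] := hyperline_ex IH fL.
  by exists (Some (Y, Z)) => _; exists Y, Z.
pose X : hyperlines (rank_datum E n) := fun Y Z => exists L Y0 Z0,
  [/\ is_flat L, f L = Some (Y0, Z0) &
      (Y = Y0 /\ Z = Z0) \/ (Y = rd_opp Y0 /\ Z = hseq2_opp Z0)].
have XP Y Z : X Y Z -> exists2 L, is_flat L & hyperline L Y Z.
  case=> L [Y0 [Z0 [fL eL eYZ]]]; exists L => //.
  have [Y' [Z' []]] := hf L fL; rewrite eL => -[<- <-] hyp.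
  by case: eYZ => -[-> ->] //; exact: hyperline_opp.
have chi_take s : chi s != 0 -> independent (take n s).
  move=> cs; have /andP[/eqP ss _] := cho_oriented H cs.
  have : size (drop n s) = 2%N by rewrite size_drop ss; lia.
  case ed : (drop n s) => [|z1 [|z2 []]] // _; exists z1, z2.
  by rewrite -ed cat_take_drop.
have posE s : @hyperlines_posbase E n (rank_datum E n) X s <-> chi s = 1.
  split=> [[os [Y [Z [/XP[L fL [hY hZ Yflat YZ]] Ys Zs]]]]|cs].
    have [iu eL] := Yflat _ Ys.
    rewrite -(cat_take_drop n s); case: (YZ _ iu eL) => -[Yu Zt]; first exact/Zt.
    have [HY _] := hseq_oriented_bases hY.
    by case: (ob_opp HY Ys Yu).
  have cs0 : chi s != 0 by rewrite cs.
  split; first exact: (cho_oriented H).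
  have iu := chi_take s cs0.
  have fL : is_flat (flat (take n s)) by exists (take n s).
  have [Y0 [Z0 [eL [hY hZ Yflat YZ]]]] := hf _ fL.
  case: (YZ _ iu erefl) => -[Yu Zt].
    exists Y0, Z0; split=> //; first by exists (flat (take n s)), Y0, Z0; split=> //; left.
    by apply/Zt; rewrite cat_take_drop.
  exists (rd_opp Y0), (hseq2_opp Z0); split.
  - by exists (flat (take n s)), Y0, Z0; split=> //; right.
  - exact/(rd_posbase_opp (r := n)).
  - by apply/hseq2_posbase_opp/Zt; rewrite cat_take_drop.
exists X; split; last exact: posE.
have : @is_hyperlines E n (rank_datum E n) F X; last by [].
split.
- have [s /chi_take iu _] := cho_C1 H e0F.
  have fL : is_flat (flat (take n s)) by exists (take n s).
  have [Y0 [Z0 [eL _]]] := hf _ fL; exists Y0, Z0, (flat (take n s)), Y0, Z0.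
  by split=> //; left.
- move=> Y Z /XP[L [s _ eL] [hY hZ _ _]]; exists L, (F :\: L); split=> //.
    apply/setP => e; rewrite in_setU in_setD.
    have [eF|//] := boolP (e \in L); move: eF; rewrite -eL inE => /andP[-> _].
    by [].
  by apply/pred0P => e /=; rewrite in_setD; case: (e \in L).
- move=> Y1 Z1 Y2 Z2 FY2 s XYZ1 XYZ2 Y1s hY2 sub.
  move: (XYZ1) (XYZ2) => [L1 [Y01 [Z01 [fL1 e1 c1]]]] [L2 [Y02 [Z02 [fL2 e2 c2]]]].
  (* A base of [Y1] spans [L1] and here lies in [L2], a flat of the same rank. *)
  have eL : L1 = L2.
    have line Y Z L Y0 Z0 : is_flat L -> f L = Some (Y0, Z0) ->
        (Y = Y0 /\ Z = Z0) \/ (Y = rd_opp Y0 /\ Z = hseq2_opp Z0) ->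
        hyperline L Y Z.
      move=> fL e c; have [Y' [Z' []]] := hf L fL; rewrite e => -[<- <-] hyp.
      by case: c => -[-> ->] //; exact: hyperline_opp.
    have [_ _ Yflat _] := line _ _ _ _ _ fL1 e1 c1.
    have [hL2 _ _ _] := line _ _ _ _ _ fL2 e2 c2.
    have [is_ <-] := Yflat _ Y1s.
    case: fL2 hL2 {c2 e2} => s2 is2 <- hL2.
    apply: (flat_eq H) => //; move: sub.
    by rewrite (is_hseq_ground_uniq (hY2 : is_hseq FY2 (Y2 : hseq E n)) hL2).
  move: e2; rewrite -eL e1 => -[? ?]; subst Y02 Z02.
  have rf := rd_eq_refl (r := n); have rK := rd_eq_oppK (r := n).
  case: c1 c2 => -[-> ->] [] [-> ->]; [left|right|right|left]; split=> //.
  + exact: hseq2_eq_refl.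
  + by rewrite hseq2_oppK; exact: hseq2_eq_refl.
  + exact: hseq2_eq_refl.
  + exact: hseq2_eq_refl.
- move=> s x t /posE cs /posE ct.
  have [||y yt hy] := cho_C3 H (s := s) (x := x) (t := t); rewrite ?cs ?ct //.
  exists y => //; rewrite !posE.
  have [h|h|h] := chi_cases (rcons s y) H; [right| |by left].
    by rewrite -!cats1 (cho_bar H) cats1 h opprK.
  by rewrite h in hy.
- move=> p x y z; rewrite !posE.
  by rewrite (cho_bar H) -(cho_swap H).
Qed.

End HigherRank.

Theorem chirotope_hseq r F chi : (0 < r)%N -> F != set0 ->
  chirotope_on F r chi ->
  exists X : hseq E r, is_hseq F X /\ forall s, hseq_posbase X s <-> chi s = 1.
Proof.
elim/ltn_ind: r F chi => -[|[|[|q]]] IH F chi // _ F0 H.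
- exact: chirotope1_hseq1.
- by have [Z hZ Zs] := chirotope2_hseq2 F0 H; exists Z.
- by apply: chirotope_hyperlines => // F' chi' F'0; apply: IH.
Qed.

End Converse.

(** [E] is nonempty in the converse because hyperline sequences have nonempty ground sets, whereas
    the zero map is a chirotope over the empty set. *)
Theorem theorem3p1 (disp : Order.disp_t) (E : finOrderType disp) (r : nat)
    (r_ge1 : (1 <= r)%N) :
  (forall X : hseq E r, is_hseq [set: E] X ->
     exists chi : seq (signed E) -> int, chirotope r chi /\
       (forall s : seq (signed E), hseq_posbase X s <-> chi_posbase chi s))
  /\
  ((0 < #|E|)%N ->
   forall chi : seq (signed E) -> int, chirotope r chi ->
     exists X : hseq E r, is_hseq [set: E] X /\
       (forall s : seq (signed E), chi_posbase chi s <-> hseq_posbase X s)).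
Proof.
split=> [X /hseq_oriented_bases[_ H]|E0 chi /(chirotope_onT r_ge1) H].
  exists (chi_of (hseq_posbase X)); split; first exact: chirotopeT.
  by move=> s; apply: iff_sym; exact: chi_of1.
have T0 : [set: E] != set0 by rewrite -card_gt0 cardsT.
have [X [hX Xs]] := chirotope_hseq r_ge1 T0 H.
by exists X; split=> // s; apply: iff_sym; exact: Xs.
Qed.
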